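(* Define structure constants $\mathbb{t}^w_{u,v}\in Q^a$ by $\mathrm{stab}^-_u\cdot\mathrm{stab}^-_v=\sum_{w\in W}\mathbb{t}^w_{u,v}\,\mathrm{stab}^-_w$ in $(Q_W^a)^*$, for $u,v\in W$. The classes $\mathrm{stab}^-_w$ and the coefficients $\mathbb{t}^w_{u,v}$ satisfy the following properties: (1) $\mathrm{stab}^-_w=(-1)^{\ell(w_0)}\,\widehat\alpha_{w_0}\,T_w^*$ for all $w\in W$. (2) For each $w\in W$ fix a reduced sequence $I_w=(i_1,\dots,i_k)$ for $w$, $k=\ell(w)$. Then $$\mathbb{t}^w_{u,v}=\sum_{\substack{E,F\subset[\ell(w)]\\ \prod(I_w|_E)=u,\ \prod(I_w|_F)=v}}\widehat\alpha_{w_0}^{\,2}\,\mathbf{t}^{I_w}_{E,F},$$ where $\mathbf{t}^{I_w}_{E,F}=(B^T_1B^T_2\cdots B^T_k)\cdot 1$ with $$B^T_j=\begin{cases}\dfrac{\alpha_{i_j}}{\widehat\alpha_{i_j}}\,\delta_{i_j},& j\in E\cap F,\\[2mm] \dfrac{h}{\widehat\alpha_{i_j}}\,\delta_{i_j},& j\in E\text{ or }F\text{ but not both},\\[2mm] -\dfrac{h}{\alpha_{i_j}}+\dfrac{h^2}{\alpha_{i_j}\widehat\alpha_{i_j}}\,\delta_{i_j},& j\notin E\cup F.\end{cases}$$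
   Context: Let $\Sigma\hookrightarrow\Lambda^\vee$ be a semisimple root datum with lattice $\Lambda\supset\Sigma$, simple roots $\alpha_1,\dots,\alpha_n$, and Weyl group $W$ generated by $s_i=s_{\alpha_i}$, with length function $\ell$, identity $e$ and longest element $w_0$. Write $\alpha>0$ for positive roots and $[k]=\{1,\dots,k\}$. Let $R^a=\mathbb{Z}[h]$, $S^a=\operatorname{Sym}_{R^a}(\Lambda)$, $Q^a=\operatorname{Frac}(S^a)$, with $W$ acting via its action on $\Lambda$ and trivially on $h$. $Q^a_W=Q^a\rtimes_{R^a}R^a[W]$ is the free left $Q^a$-module with basis $\{\delta_w\}_{w\in W}$ and product $(p\delta_w)(p'\delta_{w'})=p\,w(p')\,\delta_{ww'}$; write $\delta_i=\delta_{\alpha_i}=\delta_{s_i}$. It acts on $Q^a$ by $(p\delta_w)\cdot p'=p\,w(p')$. Notation: $\widehat\alpha=h-\alpha$, $\alpha_{w_0}=\prod_{\alpha>0}\alpha$, $\widehat\alpha_{w_0}=\prod_{\alpha>0}(h-\alpha)$ (and $\widehat\alpha_{i}=h-\alpha_i$ for simple roots). For a simple root $\alpha$ let $T_\alpha=-\frac{h}{\alpha}(1-\delta_\alpha)-\delta_\alpha=-\frac{h}{\alpha}+\frac{\widehat\alpha}{\alpha}\delta_\alpha\in Q^a_W$. These satisfy the braid relations and $T_\alpha^2=1$, so $T_w=T_{\alpha_{i_1}}\cdots T_{\alpha_{i_\ell}}$ is well defined for any expression $w=s_{i_1}\cdots s_{i_\ell}$, reduced or not, and $\{T_w\}_{w\in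 W}$ is a $Q^a$-basis of $Q^a_W$. $(Q^a_W)^*=\operatorname{Hom}_{Q^a}(Q^a_W,Q^a)$ has the basis $\{f_w\}$ dual to $\{\delta_w\}$ and the basis $\{T_w^*\}$ dual to $\{T_w\}$. It is a commutative ring under the product determined by $\langle fg,\delta_w\rangle=\langle f,\delta_w\rangle\langle g,\delta_w\rangle$ for all $w\in W$, with unity $\sum_{w\in W}f_w$. $Q^a_W$ acts on $(Q^a_W)^*$ by $\langle z\bullet f,z'\rangle=\langle f,z'z\rangle$. The cohomological stable basis considered here is $\mathrm{stab}^-_w=(-1)^{\ell(w_0)}T_{w^{-1}w_0}\bullet(\alpha_{w_0}f_{w_0})$, $w\in W$, a $Q^a$-basis of $(Q^a_W)^*$. For a sequence $I=(i_1,\dots,i_k)$ and $E\subset[k]$, $I|_E$ is the subsequence of entries in positions in $E$, and $\prod I=s_{i_1}\cdots s_{i_k}\in W$ is the ordinary product in $W$ ($e$ for the empty sequence). $I_w$ is a reduced sequence for $w$ if $\prod I_w=w$ and $I_w$ has $\ell(w)$ entries.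
   Formalization: In (2) the printed prefactor $\widehat\alpha_{w_0}^2$ is replaced by $(-1)^{\ell(w_0)}\widehat\alpha_{w_0}$, since the printed formula fails in rank one, where $\mathbb{t}^s_{s,s}=-\alpha$ but it gives $\alpha(h-\alpha)$. *)

(* Defs.v *)
From HB Require Import structures.
From mathcomp Require Import all_boot all_order all_fingroup all_algebra.
From mathcomp Require Import finmap boolp.
From mathcomp.multinomials Require Import mpoly.

Set Implicit Arguments.
Unset Strict Implicit.
Unset Printing Implicit Defensive.

Import GRing.Theory.
Local Open Scope ring_scope.

(* The lattice is Lambda = Z^r, as column vectors, and its dual is the space  *)
(* of row vectors; [pairing c l] is the value of c on l.                      *)
Definition pairing r (c : 'rV[int]_r) (l : 'cV[int]_r) : int := (c *m l) 0 0.

Record root_datum (r : nat) := RootDatum {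
  roots : {fset 'cV[int]_r};
  coroot : roots -> 'rV[int]_r;
  coroot_inj : injective coroot;
  coroot_root : forall a : roots, pairing (coroot a) (val a) = 2;
  roots_refl : forall a b : roots,
    val b - pairing (coroot a) (val b) *: val a \in roots;
  coroots_refl : forall a b : roots, exists c : roots,
    coroot c = coroot b - pairing (coroot b) (val a) *: coroot a;
  roots_reduced : forall a : roots, val a *+ 2 \notin roots }.

(* A root datum whose roots span a sublattice of finite index, together with  *)
(* a choice of simple roots.                                                  *)
Record semisimple_datum (r n : nat) := SemisimpleDatum {
  datum :> root_datum r;
  roots_span : forall l : 'cV[int]_r, exists (m : int) (c : roots datum -> int),
    m != 0 /\ m *: l = \sum_(a : roots datum) c a *: val a;
  simple : 'I_n -> roots datum;
  simple_free : forall c : 'I_n -> int,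
    \sum_(i < n) c i *: val (simple i) = 0 -> forall i, c i = 0;
  simple_base : forall a : roots datum, exists c : 'I_n -> nat,
    val a = \sum_(i < n) val (simple i) *+ c i
    \/ val a = - \sum_(i < n) val (simple i) *+ c i }.

Definition positive r n (D : semisimple_datum r n) (a : roots D) : bool :=
  `[< exists c : 'I_n -> nat, val a = \sum_(i < n) val (simple D i) *+ c i >].

Section WeylGroup.
Variables (r n : nat) (D : semisimple_datum r n).
Local Notation Rt := (roots D).

Definition reflect_root (a b : Rt) : Rt := FSetSub (roots_refl a b).

Lemma reflect_rootK (a : Rt) : involutive (reflect_root a).
Proof.
move=> b; apply: val_inj => /=.
have -> : pairing (coroot a) (val b - pairing (coroot a) (val b) *: val a)
          = - pairing (coroot a) (val b).
  have := coroot_root a; rewrite /pairing mulmxBr -scalemxAr => E.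
  by rewrite [LHS]mxE [X in _ + X]mxE [X in _ - X]mxE E mulr_natr mulr2n opprD addNKr.
by rewrite scaleNr opprK subrK.
Qed.

Definition reflect_perm (a : Rt) : {perm Rt} := perm (inv_inj (reflect_rootK a)).

(* W is realized on the finite set of roots. Permutations compose from left   *)
(* to right in the library, so w acts on a root through the permutation w^-1, *)
(* which makes the action a left one: (u * v) a = u (v a).                    *)
Definition weyl_group : {group {perm Rt}} :=
  <<[set reflect_perm (simple D i) | i : 'I_n]>>%G.

Definition weyl : finGroupType := subg_of weyl_group.

Definition weyl_act (w : weyl) (a : Rt) : Rt := ((sgval w)^-1)%g a.

Definition simple_refl (i : 'I_n) : weyl := subg weyl_group (reflect_perm (simple D i)).

Definition word_prod (I : seq 'I_n) : weyl := (\prod_(i <- I) simple_refl i)%g.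

Lemma simple_reflE i : sgval (simple_refl i) = reflect_perm (simple D i).
Proof. by apply: subgK; apply/mem_gen/imset_f. Qed.

Lemma simple_refl_act i a : weyl_act (simple_refl i) a = reflect_root (simple D i) a.
Proof.
rewrite /weyl_act simple_reflE; apply: (can_inj (permK (reflect_perm (simple D i)))).
by rewrite permKV !permE reflect_rootK.
Qed.

Lemma weyl_actM u v a : weyl_act (u * v)%g a = weyl_act u (weyl_act v a).
Proof. by rewrite /weyl_act invMg permM. Qed.

Lemma weyl_act1 a : weyl_act 1%g a = a.
Proof. by rewrite /weyl_act invg1 perm1. Qed.

Lemma weyl_word (w : weyl) : exists k, [exists I : k.-tuple 'I_n, word_prod I == w].
Proof.
have /gen_prodgP[k [c cA wE]] := subgP w.
have /fin_all_exists[f fE] : forall j, exists i, c j = reflect_perm (simple D i).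
  by move=> j; have /imsetP[i _ ->] := cA j; exists i.
exists k; apply/existsP; exists [tuple f j | j < k]; apply/eqP.
apply: val_inj; rewrite /word_prod big_tuple.
rewrite -[RHS]/(sgval w) wE -[LHS]/(sgval _).
rewrite (big_morph _ (fun u v => erefl (sgval (u * v)%g)) erefl).
by apply: eq_bigr => j _; rewrite simple_reflE tnth_mktuple fE.
Qed.

Definition wlen (w : weyl) : nat := ex_minn (weyl_word w).

Lemma weyl_reduced_word (w : weyl) : exists I : (wlen w).-tuple 'I_n, word_prod I == w.
Proof. by rewrite /wlen; case: ex_minnP => k /existsP. Qed.

Definition reduced_word (w : weyl) : (wlen w).-tuple 'I_n :=
  xchoose (weyl_reduced_word w).

Definition w0 : weyl := [arg max_(w > 1%g) wlen w].

(* The action of w on the lattice: the unique endomorphism of Lambda that     *)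
(* induces w on the roots.                                                    *)
Definition extends_act (w : weyl) (M : 'M[int]_r) : bool :=
  [forall a : Rt, M *m val a == val (weyl_act w a)].

Definition reflect_mx (a : Rt) : 'M[int]_r := 1%:M - val a *m coroot a.

Lemma reflect_mxE a l : reflect_mx a *m l = l - pairing (coroot a) l *: val a.
Proof.
rewrite mulmxBl mul1mx -mulmxA [coroot a *m l]mx11_scalar mul_mx_scalar.
by rewrite /pairing.
Qed.

Lemma weyl_mx_ex (w : weyl) : exists M, extends_act w M.
Proof.
have [k /existsP[I /eqP <-]] := weyl_word w.
elim: (tval I) => [|i s [M /forallP MP]].
  exists 1%:M; apply/forallP => a.
  by rewrite /word_prod big_nil weyl_act1 mul1mx.
exists (reflect_mx (simple D i) *m M); apply/forallP => a.
rewrite /word_prod big_cons weyl_actM simple_refl_act -mulmxA.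
by rewrite (eqP (MP a)) reflect_mxE.
Qed.

Definition weyl_mx (w : weyl) : 'M[int]_r := xchoose (weyl_mx_ex w).

Lemma weyl_mxP w a : weyl_mx w *m val a = val (weyl_act w a).
Proof. by have /forallP/(_ a)/eqP := xchooseP (weyl_mx_ex w). Qed.

Lemma extends_act_uniq w M N : extends_act w M -> extends_act w N -> M = N.
Proof.
move=> /forallP MP /forallP NP; suff E (l : 'cV_r) : M *m l = N *m l.
  by apply/matrixP => i j; move/colP/(_ i): (E (delta_mx j 0)); rewrite -!colE !mxE.
have [m [c [m0 lE]]] := roots_span D l.
have : m *: (M *m l) = m *: (N *m l).
  rewrite !scalemxAr lE !mulmx_sumr; apply: eq_bigr => a _.
  by rewrite -!scalemxAr (eqP (MP a)) (eqP (NP a)).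
move/matrixP => H; apply/matrixP => i j; have := H i j.
by rewrite mxE [RHS]mxE => /(mulfI m0).
Qed.

Lemma weyl_mxM u v : weyl_mx (u * v)%g = weyl_mx u *m weyl_mx v.
Proof.
apply: (@extends_act_uniq (u * v)%g); apply/forallP => a; apply/eqP.
  exact: weyl_mxP.
by rewrite -mulmxA !weyl_mxP weyl_actM.
Qed.

Lemma weyl_mx_simple i (l : 'cV_r) :
  weyl_mx (simple_refl i) *m l =
  l - pairing (coroot (simple D i)) l *: val (simple D i).
Proof.
rewrite -reflect_mxE; congr (_ *m _).
apply: (@extends_act_uniq (simple_refl i)); apply/forallP => a; apply/eqP.
  exact: weyl_mxP.
by rewrite reflect_mxE simple_refl_act.
Qed.

End WeylGroup.

(* The twisted group algebra K_W of a group W acting on a field K, as a left  *)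
(* K-module with basis delta, and its K-linear dual.                          *)
Section TwistedAlgebra.
Variables (W : finGroupType) (K : fieldType) (act : W -> K -> K).

Definition twisted : vectType K := {ffun W -> K^o}.

Definition delta (w : W) : twisted := [ffun x => (x == w)%:R].

Definition tcoef (z : twisted) (w : W) : K := (z : {ffun W -> K^o}) w.

Definition tmul (z z' : twisted) : twisted :=
  \sum_(u : W) \sum_(v : W) (tcoef z u * act u (tcoef z' v)) *: delta (u * v)%g.

Definition tact (z : twisted) (p : K) : K := \sum_(w : W) tcoef z w * act w p.

Definition tdual : vectType K := 'Hom(twisted, K^o).

Definition pair_dual (f : tdual) (z : twisted) : K := (f : 'Hom(twisted, K^o)) z.

Definition dual_mul (f g : tdual) : tdual :=
  linfun (fun z : twisted =>
    \sum_(w : W) tcoef z w * (pair_dual f (delta w) * pair_dual g (delta w)) : K^o).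

Definition bullet (z : twisted) (f : tdual) : tdual :=
  linfun (fun z' : twisted => pair_dual f (tmul z' z) : K^o).

(* The basis of the dual space that is dual to the basis b of K_W.            *)
Definition dual_basis (b : W -> twisted) (w : W) : tdual :=
  linfun (fun z : twisted =>
    coord [tuple b (enum_val i) | i < #|W|] (enum_rank w) z : K^o).

End TwistedAlgebra.

(* S^a = Sym_{Z[h]}(Lambda), a polynomial ring on the standard basis of Z^r,  *)
(* and Q^a its field of fractions.                                            *)
Definition Sa (r : nat) : idomainType := {mpoly {poly int}[r]}.
Definition Qa (r : nat) : fieldType := {fraction (Sa r)}.

Local Notation "x %:F" := (@FracField.tofrac _ x).

Definition linS r (l : 'cV[int]_r) : Sa r :=
  (\sum_(j < r) 'X_j *~ l j 0 : {mpoly {poly int}[r]}).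

Definition linQ r (l : 'cV[int]_r) : Qa r := (linS l)%:F.

Definition hQ r : Qa r := (mpolyC r 'X : Sa r)%:F.

(* The extension to fractions of an injective ring endomorphism.              *)
Definition frac_map (A : idomainType) (f : A -> A) (x : {fraction A}) : {fraction A} :=
  (f (\n_(generic_quotient.repr x)))%:F / (f (\d_(generic_quotient.repr x)))%:F.

Section StableBasis.
Variables (r n : nat) (D : semisimple_datum r n).
Local Notation W := (weyl D).
Local Notation Q := (Qa r).
Local Notation h := (hQ r).

Definition actS (w : W) (p : Sa r) : Sa r :=
  (p : {mpoly {poly int}[r]}) \mPo [tuple linS (col j (weyl_mx w)) | j < r].

Definition actQ (w : W) : Q -> Q := frac_map (actS w).

Local Notation QW := (twisted W Q).
Local Notation QWdual := (tdual W Q).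

Definition alphaQ (i : 'I_n) : Q := linQ (val (simple D i)).

Definition alpha_w0 : Q := \prod_(a : roots D | positive a) linQ (val a).

Definition hat_alpha_w0 : Q := \prod_(a : roots D | positive a) (h - linQ (val a)).

Definition delta_s (i : 'I_n) : QW := delta Q (simple_refl D i).

Definition T_simple (i : 'I_n) : QW :=
  - (h / alphaQ i) *: delta Q 1%g + ((h - alphaQ i) / alphaQ i) *: delta_s i.

(* The product does not depend on the chosen word: the T_simple i satisfy the *)
(* braid relations and square to 1.                                           *)
Definition T_ (w : W) : QW :=
  \big[tmul actQ/delta Q 1%g]_(i <- reduced_word w) T_simple i.

Definition T_dual (w : W) : QWdual := dual_basis T_ w.

Definition f_ (w : W) : QWdual := dual_basis (@delta W Q) w.

Definition stab (w : W) : QWdual :=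
  (-1) ^+ wlen (w0 D) *: bullet actQ (T_ (w^-1 * w0 D)%g) (alpha_w0 *: f_ (w0 D)).

Definition subword k (I : k.-tuple 'I_n) (E : {set 'I_k}) : seq 'I_n :=
  [seq tnth I j | j <- enum E].

Definition BT k (I : k.-tuple 'I_n) (E F : {set 'I_k}) (j : 'I_k) : QW :=
  let a := alphaQ (tnth I j) in
  let d := delta_s (tnth I j) in
  if (j \in E) && (j \in F) then (a / (h - a)) *: d
  else if (j \in E) || (j \in F) then (h / (h - a)) *: d
  else - (h / a) *: delta Q 1%g + (h ^+ 2 / (a * (h - a))) *: d.

Definition t_EF k (I : k.-tuple 'I_n) (E F : {set 'I_k}) : Q :=
  tact actQ (\big[tmul actQ/delta Q 1%g]_(j < k) BT I E F j) 1.

End StableBasis.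

(* Main.v *)
From HB Require Import structures.
From mathcomp Require Import all_boot all_order all_fingroup all_algebra.
From mathcomp Require Import finmap boolp.
From mathcomp.multinomials Require Import mpoly.
From mathcomp Require Import zify ring.
Require Import Defs.

(** Everything rests on two properties of the elements [T_i]: the product
[T_I] of the letters of a word [I] depends only on the element of [W] that
[I] spells, and it has a computable leading coefficient.

Independence of the word ([T_word_unique]) is proved without the braid relations.
The rule [T_i x = s_i(x) T_i - h <alpha_i^v, x>] moves a linear form [x] through
[T_I], giving [T_I x = w(x) T_I - h R], where [R] is a combination of products
[T_K] over the words [K] got by erasing one letter of [I]. By induction on
the length each [T_K] depends only on the product of [K], and the coefficients
collected on one element of [W] depend only on [w] and [x]
([deletions_sum]). For two words [I] and [J] of the same [w], the difference
[d = T_I - T_J] therefore satisfies [d x = w(x) d] for all [x], which forces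
[d] to be a multiple of [delta_w]. Since [T_i] maps 1 to -1 and the lengths
of [I] and [J] have the same parity ([word_parity]), [d] kills 1, so [d = 0].
Consequently [T_u T_v = T_(uv)].

For the leading coefficient, expand [T_I] over the subwords of [I]. An element of
[W] whose length is at least that of [I] can only be produced by [I] itself, with
coefficient the product of [(h - b) / b] over the roots
[b = s_i1 ... s_i(j-1) alpha_ij] ([tcoef_T_word]). For a reduced word of the
longest element these [b] are the positive roots, each once
([inversions_w0]).

Part (1): the value of [stab_u] at [T_v] is, up to sign and the product of the
positive roots, the coefficient of [T_(v u^-1 w0)] at [w0]. It vanishes unless
[u = v], and for [u = v] the leading coefficient turns the product of the roots
into the product of the [h - a] ([pair_stable_class]). In particular the [T_w] are
linearly independent and the [stab_w] are proportional to the dual basis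
([T_elt_free], [stable_class_dual]).

Part (2): the product of functionals is dual to the diagonal coproduct
[delta_w |-> delta_w (x) delta_w], so the structure constants are the
coefficients of the coproduct of [T_w] in the basis of the [T_u (x) T_v]. The
operators [B_j] compute them one letter at a time ([coproduct_T_word]), and
independence of the word identifies [T_(I|E)] with the [T_u] of its product. *)

Set Implicit Arguments.
Unset Strict Implicit.
Unset Printing Implicit Defensive.

Import Order.TTheory GRing.Theory Num.Theory.
Local Open Scope ring_scope.

(** * Roots, coroots and positivity *)

Section Roots.
Variables (r n : nat) (D : semisimple_datum r n).
Local Notation Rt := (roots D).

Lemma pairingBr (c : 'rV[int]_r) x y : pairing c (x - y) = pairing c x - pairing c y.
Proof. by rewrite /pairing mulmxBr !mxE. Qed.

Lemma pairingBl (c d : 'rV[int]_r) x : pairing (c - d) x = pairing c x - pairing d x.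
Proof. by rewrite /pairing mulmxBl !mxE. Qed.

Lemma pairingZr (c : 'rV[int]_r) m x : pairing c (m *: x) = m * pairing c x.
Proof. by rewrite /pairing -scalemxAr mxE. Qed.

Lemma pairingNl (c : 'rV[int]_r) x : pairing (- c) x = - pairing c x.
Proof. by rewrite /pairing mulNmx mxE. Qed.

Lemma pairingNr (c : 'rV[int]_r) x : pairing c (- x) = - pairing c x.
Proof. by rewrite /pairing mulmxN mxE. Qed.

Lemma scale_posz (k : nat) (x : 'cV[int]_r) : k%:Z *: x = x *+ k.
Proof. by rewrite -[k%:Z]natz scaler_nat. Qed.

Lemma root_neq0 (a : Rt) : val a != 0.
Proof.
by apply/eqP => a0; have := coroot_root a; rewrite a0 /pairing mulmx0 mxE.
Qed.

Lemma eq_on_roots (f g : 'rV[int]_r) :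
  (forall b : Rt, pairing f (val b) = pairing g (val b)) -> f = g.
Proof.
move=> fg; apply/eqP; rewrite -subr_eq0; apply/eqP/rowP => j; rewrite [RHS]mxE.
have [m [c [m0 E]]] := roots_span D (delta_mx j 0).
have : m * pairing (f - g) (delta_mx j 0) = 0.
  rewrite -pairingZr E /pairing mulmx_sumr summxE big1 // => b _.
  rewrite -scalemxAr mxE -/(pairing _ _) pairingBl fg subrr mulr0 //.
move/eqP; rewrite mulf_eq0 (negPf m0) /= => /eqP.
by rewrite /pairing -colE !mxE.
Qed.

(** Two reflections in the same root that both preserve the finite set of roots
differ by a transvection [b |-> b - g(b) a] with [g(a) = 0]. Its powers are
[b |-> b - k g(b) a], so finiteness forces [g = 0]. *)
Lemma coroot_unique (a : Rt) (f : 'rV[int]_r) :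
    pairing f (val a) = 2 ->
    (forall b : Rt, val b - pairing f (val b) *: val a \in roots D) ->
  f = coroot a.
Proof.
move=> fa fR; apply: eq_on_roots => b; apply/eqP; rewrite -subr_eq0; apply: contraT.
rewrite -pairingBl => gb0; set g := f - coroot a in gb0.
have ga : pairing g (val a) = 0 by rewrite pairingBl fa coroot_root subrr.
(* The [k]-th iterate of the composite of the two reflections, applied to [b]. *)
have step k : val b - (k%:Z * pairing g (val b)) *: val a \in roots D.
  elim: k => [|k IHk]; first by rewrite mul0r scale0r subr0 fsvalP.
  have := fR (reflect_root a [` IHk]%fset); rewrite /= !(pairingBr, pairingZr).
  rewrite fa coroot_root; congr (in_mem _ _).
  rewrite -!addrA -!opprD -!scalerDl pairingBl; congr (_ - _ *: _).
  rewrite intS; ring.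
have inj : injective (fun k : 'I_(#|{: Rt}|).+1 => [` step k]%fset).
  move=> k l /(congr1 val) /= /addrI /oppr_inj /eqP.
  rewrite -subr_eq0 -scalerBl scalemx_eq0 (negPf (root_neq0 a)) orbF -mulrBl mulf_eq0.
  by rewrite (negPf gb0) orbF subr_eq0 => /eqP[] /val_inj.
by have := leq_card _ inj; rewrite card_ord ltnn.
Qed.


Definition opp_root (a : Rt) : Rt := reflect_root a a.

Lemma val_opp_root a : val (opp_root a) = - val a.
Proof. by rewrite /= coroot_root scaler_nat mulr2n opprD addNKr. Qed.

Lemma opp_rootK : involutive opp_root.
Proof. by move=> a; apply: val_inj; rewrite !val_opp_root opprK. Qed.

Lemma coroot_opp a : coroot (opp_root a) = - coroot a.
Proof.
apply/esym/coroot_unique; first by rewrite val_opp_root pairingNl pairingNr coroot_root opprK.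
by move=> b; rewrite val_opp_root pairingNl scaleNr scalerN opprK; apply: roots_refl.
Qed.

Lemma reflect_mx_opp a : reflect_mx (opp_root a) = reflect_mx a.
Proof. by rewrite /reflect_mx coroot_opp val_opp_root mulNmx mulmxN opprK. Qed.

Lemma weyl_act_opp (w : weyl D) a : weyl_act w (opp_root a) = opp_root (weyl_act w a).
Proof. by apply: val_inj; rewrite val_opp_root -!weyl_mxP val_opp_root mulmxN. Qed.

Lemma weyl_actK (w : weyl D) : cancel (weyl_act w) (weyl_act w^-1%g).
Proof. by move=> a; rewrite -weyl_actM mulVg weyl_act1. Qed.

Lemma weyl_actVK (w : weyl D) : cancel (weyl_act w^-1%g) (weyl_act w).
Proof. by move=> a; rewrite -weyl_actM mulgV weyl_act1. Qed.

Lemma weyl_mx1 : weyl_mx (1%g : weyl D) = 1%:M.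
Proof.
apply: (@extends_act_uniq _ _ D 1%g); apply/forallP => a; apply/eqP.
  exact: weyl_mxP.
by rewrite mul1mx weyl_act1.
Qed.

Lemma weyl_mx_inj : injective (@weyl_mx r n D).
Proof.
move=> u v uv; apply: val_inj; apply: invg_inj; apply/permP => a.
by apply: val_inj; have := congr1 (mulmx^~ (val a)) uv; rewrite !weyl_mxP.
Qed.

(** The composite of [coroot a] with [w^-1] qualifies as a coroot of [w a], so
it is that coroot. *)
Lemma coroot_act (w : weyl D) a : coroot (weyl_act w a) *m weyl_mx w = coroot a.
Proof.
have E x : pairing (coroot a *m weyl_mx w^-1%g) x = pairing (coroot a) (weyl_mx w^-1%g *m x).
  by rewrite /pairing mulmxA.
have <- : coroot a *m weyl_mx w^-1%g = coroot (weyl_act w a); last first.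
  by rewrite -mulmxA -weyl_mxM mulVg weyl_mx1 mulmx1.
apply: coroot_unique => [|b]; rewrite E weyl_mxP; first by rewrite weyl_actK coroot_root.
rewrite -{1}[b](weyl_actVK w); set b' := weyl_act _ b.
rewrite -!(weyl_mxP w) scalemxAr -mulmxBr.
by rewrite -[X in _ *m X]/(val (reflect_root a b')) weyl_mxP fsvalP.
Qed.

Lemma reflect_mx_conj (w : weyl D) a :
  weyl_mx w *m reflect_mx a = reflect_mx (weyl_act w a) *m weyl_mx w.
Proof.
rewrite /reflect_mx mulmxBr mulmxBl mulmx1 mul1mx mulmxA weyl_mxP.
by rewrite -[in RHS]mulmxA coroot_act.
Qed.

Lemma weyl_mx_refl i : weyl_mx (simple_refl D i) = reflect_mx (simple D i).
Proof.
apply: (@extends_act_uniq _ _ D (simple_refl D i)); apply/forallP => a; apply/eqP.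
  exact: weyl_mxP.
by rewrite reflect_mxE simple_refl_act.
Qed.

Lemma simple_reflK i : (simple_refl D i * simple_refl D i)%g = 1%g.
Proof.
apply: val_inj; apply: invg_inj; apply/permP => a; rewrite -/(weyl_act _ _) -/(weyl_act _ a).
by rewrite weyl_actM !simple_refl_act reflect_rootK weyl_act1.
Qed.

Lemma simple_reflV i : (simple_refl D i)^-1%g = simple_refl D i.
Proof. by apply/eqP; rewrite eq_invg_mul simple_reflK. Qed.

Lemma simple_reflKl i (w : weyl D) : (simple_refl D i * (simple_refl D i * w))%g = w.
Proof. by rewrite mulgA simple_reflK mul1g. Qed.

Lemma positiveN (a : Rt) : positive (opp_root a) = ~~ positive a.
Proof.
have Epos (b : Rt) : reflect (exists c : 'I_n -> nat,
    val b = \sum_(i < n) val (simple D i) *+ c i) (positive b) by exact: asboolP.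
apply/Epos/idP => [[c cE]|/Epos na].
  apply/negP => /Epos[d dE].
  have := root_neq0 a; suff -> : val a = 0 by rewrite eqxx.
  rewrite dE big1 // => i _; suff -> : d i = 0%N by [].
  have: \sum_(i < n) (c i + d i)%N%:Z *: val (simple D i) = 0.
    rewrite -[RHS](addNr (val a)) -{1}val_opp_root {1}cE {1}dE -big_split /=.
    by apply: eq_bigr => j _; rewrite PoszD scalerDl !scale_posz.
  by move/simple_free => /(_ i); lia.
have [c [E|E]] := simple_base a; first by case: na; exists c.
by exists c; rewrite val_opp_root E opprK.
Qed.

Lemma simple_positive i : positive (simple D i).
Proof.
apply/asboolP; exists (fun j => (j == i)).
by rewrite (bigD1 i) //= eqxx big1 ?addr0 // => j /negPf ->.
Qed.

(** Reflecting in [alpha_i] changes only the coefficient at [alpha_i], so a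
positive root made negative is a multiple of [alpha_i]; integrality of the
pairing and reducedness leave only [alpha_i] itself. *)
Lemma positive_reflect i (a : Rt) :
  positive a -> a != simple D i -> positive (reflect_root (simple D i) a).
Proof.
move=> /asboolP[c cE]; apply: contraNT; rewrite -positiveN => /asboolP[d dE].
set m := pairing (coroot (simple D i)) (val a).
have c0 j : j != i -> c j = 0%N.
  have := simple_free (s := D) (c := fun j => (c j + d j)%:Z - m *+ (j == i)).
  move=> H; have {H}/(_ j) : forall j, (c j + d j)%:Z - m *+ (j == i) = 0.
    apply: H; transitivity (\sum_(j < n) (val (simple D j) *+ c j + val (simple D j) *+ d j)
        - \sum_(j < n) (m *+ (j == i)) *: val (simple D j)).
      rewrite -sumrB; apply: eq_bigr => k _.
      by rewrite scalerBl PoszD scalerDl !scale_posz.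
    rewrite big_split /= -cE -dE val_opp_root /= -/m (bigD1 i) //= eqxx.
    rewrite big1 ?addr0 => [|k /negPf->]; last by rewrite scale0r.
    by rewrite opprB addrC subrK subrr.
  by case: eqP => // _; rewrite mulr0n subr0 => /eqP; rewrite eqz_nat addn_eq0 => /andP[/eqP].
have aE : val a = (c i)%:Z *: val (simple D i).
  by rewrite cE (bigD1 i) //= big1 ?addr0 ?scale_posz // => j /c0 ->.
have := coroot_root a; rewrite aE pairingZr.
move=> E2; have {}E2 : c i = 1%N \/ c i = 2%N.
  have : (`|c i| * `|pairing (coroot a) (val (simple D i))| = 2)%N by rewrite -abszM E2.
  rewrite absz_nat; move: (absz _) => e.
  by case: (c i) e => [|[|[|k]]] [|[|e]] //; rewrite ?mulnS; lia.
case: E2 => E2; first by apply/eqP/val_inj; rewrite aE E2 scale1r.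
by have := roots_reduced (simple D i); rewrite -scale_posz -E2 -aE fsvalP.
Qed.

Lemma simple_opp_positive i (a : Rt) : positive a -> a != opp_root (simple D i).
Proof. by apply: contraTneq => ->; rewrite positiveN simple_positive. Qed.

Definition sgn_root (a : Rt) : int := (-1) ^+ ~~ positive a.

Lemma sgn_root_opp a : sgn_root (opp_root a) = - sgn_root a.
Proof. by rewrite /sgn_root positiveN signrN. Qed.

Lemma sgn_root_reflect i a :
  sgn_root (reflect_root (simple D i) a) =
  sgn_root a - (2 * sgn_root a) *+ (a == simple D i) - (2 * sgn_root a) *+ (a == opp_root (simple D i)).
Proof.
have ro b : reflect_root (simple D i) (opp_root b) = opp_root (reflect_root (simple D i) b).
  by rewrite -!simple_refl_act weyl_act_opp.
have si : simple D i != opp_root (simple D i).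
  by apply: simple_opp_positive; apply: simple_positive.
have [->|ai] := eqVneq a (simple D i).
  by rewrite (negPf si) -[reflect_root _ _]/(opp_root _) sgn_root_opp mulr1n mulr0n; ring.
have [->|aj] := eqVneq a (opp_root (simple D i)).
  by rewrite ro -[reflect_root _ _]/(opp_root _) !sgn_root_opp mulr1n mulr0n; ring.
rewrite !mulr0n !subr0 /sgn_root; congr (_ ^+ ~~ _).
case pa: (positive a); first exact: positive_reflect.
apply/negbTE; rewrite -positiveN -ro positive_reflect ?positiveN ?pa //.
by apply: contra aj => /eqP <-; rewrite opp_rootK.
Qed.

End Roots.

(** * Reduced words and the longest element *)

Section Words.
Variables (r n : nat) (D : semisimple_datum r n).
Local Notation Rt := (roots D).
Local Notation wprod := (word_prod D).
Implicit Types (I J K : seq 'I_n) (a b : Rt) (w : weyl D).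

Lemma word_prod_cons i J : wprod (i :: J) = (simple_refl D i * wprod J)%g.
Proof. exact: big_cons. Qed.

Lemma word_prod_nil : wprod [::] = 1%g.
Proof. exact: big_nil. Qed.

Lemma word_prod_cat I J : wprod (I ++ J) = (wprod I * wprod J)%g.
Proof. exact: big_cat. Qed.

Lemma reduced_wordP w : wprod (reduced_word w) = w.
Proof. exact/eqP/(xchooseP (weyl_reduced_word w)). Qed.

Lemma wlen_word J : (wlen (wprod J) <= size J)%N.
Proof.
rewrite /wlen; case: ex_minnP => k _; apply.
by apply/existsP; exists (in_tuple J).
Qed.

Definition reduced J := wlen (wprod J) == size J.

Lemma reduced_word_reduced w : reduced (reduced_word w).
Proof. by rewrite /reduced reduced_wordP size_tuple. Qed.

Lemma wlen_simple_mul i w : (wlen (simple_refl D i * w)%g <= (wlen w).+1)%N.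
Proof.
by rewrite -{1}(reduced_wordP w) -word_prod_cons (leq_trans (wlen_word _)) //= size_tuple.
Qed.

Lemma reduced_behead i J : reduced (i :: J) -> reduced J.
Proof.
rewrite /reduced word_prod_cons /= => /eqP E; rewrite eqn_leq wlen_word /=.
by rewrite -ltnS -E wlen_simple_mul.
Qed.

(** The roots [s_i1 ... s_i(j-1) alpha_ij]; if [I] is a reduced word for [w], they are
the positive roots made negative by [w^-1]. *)
Fixpoint inversions I : seq Rt :=
  if I is i :: J then
    simple D i :: [seq reflect_root (simple D i) b | b <- inversions J]
  else [::].

(** The strong exchange property: multiplying by the reflection in the [j]-th
root of the list erases the [j]-th letter. *)
Lemma inversions_delete a J : a \in inversions J ->
  exists K, (size K).+1 = size J /\
    weyl_mx (wprod K) = reflect_mx a *m weyl_mx (wprod J).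
Proof.
elim: J a => [//|i J IHJ] a /=; rewrite inE => /predU1P[->|/mapP[b /IHJ[K [sK pK]] ->]].
  exists J; split=> //; rewrite -weyl_mx_refl -weyl_mxM word_prod_cons.
  by rewrite simple_reflKl.
exists (i :: K); split; first by rewrite /= sK.
by rewrite !word_prod_cons !weyl_mxM pK mulmxA reflect_mx_conj simple_refl_act mulmxA.
Qed.

Lemma reduced_simple_notin i J : reduced (i :: J) -> simple D i \notin inversions J.
Proof.
rewrite /reduced => /eqP E; apply/negP => /inversions_delete[K [sK]].
rewrite -weyl_mx_refl -weyl_mxM -word_prod_cons => /weyl_mx_inj EK.
by have := wlen_word K; rewrite EK E /= -sK ltnNge leqnSn.
Qed.

(** A negative root in the list would come from [alpha_i] occurring in the list of
the tail, and then the exchange property shortens the word. *)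
Lemma reduced_inversions_positive J : reduced J -> {in inversions J, forall a, positive a}.
Proof.
elim: J => [//|i J IHJ] Jr a /=; rewrite inE => /predU1P[->|/mapP[b bJ ->]].
  exact: simple_positive.
apply: positive_reflect; first exact: IHJ (reduced_behead Jr) _ bJ.
by apply: contraTneq bJ => ->; apply: reduced_simple_notin.
Qed.

(** A repetition would, after removing the common prefix, put the opposite of a
simple root in the list of a reduced word. *)
Lemma reduced_inversions_uniq J : reduced J -> uniq (inversions J).
Proof.
elim: J => [//|i J IHJ] Jr /=; have Jr' := reduced_behead Jr.
rewrite map_inj_uniq ?IHJ //; last exact: inv_inj (reflect_rootK _).
rewrite andbT; apply/mapP => -[b bJ /(congr1 (reflect_root (simple D i)))].
rewrite reflect_rootK => E; have := reduced_inversions_positive Jr' bJ.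
by rewrite -E (positiveN (simple D i)) simple_positive.
Qed.

(** Applying the letters of the word one by one, a positive root can become
negative only at a step where it equals the simple root being reflected, and
such roots are the ones listed. *)
Lemma notin_inversions a J : positive a -> a \notin inversions J ->
  positive (weyl_act (wprod J)^-1%g a).
Proof.
elim: J a => [|i J IHJ] a ap /=; first by rewrite word_prod_nil invg1 weyl_act1.
rewrite inE negb_or => /andP[ai aJ].
rewrite word_prod_cons invMg simple_reflV weyl_actM simple_refl_act IHJ //.
  exact: positive_reflect.
by apply: contra aJ => aJ; apply/mapP; exists (reflect_root (simple D i) a); rewrite ?reflect_rootK.
Qed.

Lemma wlen_w0 w : (wlen w <= wlen (w0 D))%N.
Proof.
rewrite /w0; have [w' _ max_w'] := @arg_maxnP _ 1%g xpredT (@wlen r n D) isT.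
exact: max_w'.
Qed.

(** The sign character of the Weyl group, in a form that visibly depends on [w]
alone: among the positive roots exactly one is sent by [w] to [alpha_i] or its
opposite, and its image is the only one whose sign [s_i] changes. *)
Definition weyl_sign w : int := \prod_(a : Rt | positive a) sgn_root (weyl_act w a).

Lemma weyl_sign_simple i w : weyl_sign (simple_refl D i * w)%g = - weyl_sign w.
Proof.
set g := weyl_act w^-1%g (simple D i).
pose f a := if (a == g) || (a == opp_root g) then -1 else 1 : int.
have fE a : sgn_root (weyl_act (simple_refl D i * w)%g a) = f a * sgn_root (weyl_act w a).
  have wE b : (a == weyl_act w^-1%g b) = (weyl_act w a == b).
    by rewrite -(can_eq (weyl_actK w)) weyl_actVK.
  rewrite weyl_actM simple_refl_act sgn_root_reflect /f /g -weyl_act_opp !wE.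
  case: eqP => [->|_] /=; last by case: eqP => _; rewrite /= ?mulr1n ?mulr0n; ring.
  by rewrite (negPf (simple_opp_positive i (simple_positive D i))) mulr1n mulr0n; ring.
have [p [pp pE]] : exists p, positive p /\ forall a, positive a -> f a = if a == p then -1 else 1.
  case gp: (positive g).
    exists g; split=> // a ap; rewrite /f; case: (a =P opp_root g) => [ag|_]; last by rewrite orbF.
    by move: ap; rewrite ag positiveN gp.
  exists (opp_root g); split=> [|a ap]; first by rewrite positiveN gp.
  rewrite /f; case: (a =P g) => [ag|] //; by move: ap; rewrite ag gp.
rewrite /weyl_sign (bigD1 p) //= [X in _ = - X](bigD1 p) //= fE pE // eqxx mulN1r mulNr.
congr (- (_ * _)); apply: eq_bigr => a /andP[ap /negPf ne].
by rewrite fE pE // ne mul1r.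
Qed.

Lemma word_parity I J : wprod I = wprod J -> odd (size I) = odd (size J).
Proof.
have E K : weyl_sign (wprod K) = (-1) ^+ odd (size K).
  elim: K => [|i K IHK] /=.
    rewrite word_prod_nil; apply: big1 => a ap.
    by rewrite weyl_act1 /sgn_root ap.
  by rewrite word_prod_cons weyl_sign_simple IHK signrN.
move=> IJ; have := E I; rewrite IJ E.
by do 2!case: odd.
Qed.

(** It suffices to treat simple roots. As [w0] has maximal length and lengths change
parity, [s_i w0] is shorter than [w0], so [w0] has a reduced word beginning
with [i]; then [w0^-1 alpha_i] is the opposite of a root that stays positive. *)
Lemma w0_negative a : positive a -> ~~ positive (weyl_act (w0 D)^-1%g a).
Proof.
have simpleN i : positive (opp_root (weyl_act (w0 D)^-1%g (simple D i))).
  set J := reduced_word (simple_refl D i * w0 D)%g.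
  have pJ : wprod (i :: J) = w0 D by rewrite word_prod_cons reduced_wordP simple_reflKl.
  have Jr : reduced (i :: J).
    have lb : (wlen (w0 D) <= (size J).+1)%N by rewrite -{1}pJ wlen_word.
    have ub : (size J <= wlen (w0 D))%N by rewrite size_tuple wlen_w0.
    have := @word_parity (reduced_word (w0 D)) (i :: J).
    rewrite reduced_wordP pJ => /(_ erefl); rewrite size_tuple /= => par.
    rewrite /reduced pJ /= eqn_leq lb ltn_neqAle ub andbT.
    by apply/eqP => E; move: par; rewrite E; case: odd.
  rewrite -pJ word_prod_cons invMg simple_reflV weyl_actM simple_refl_act.
  rewrite -[reflect_root _ _]/(opp_root _) weyl_act_opp opp_rootK.
  by apply: notin_inversions; rewrite ?simple_positive ?reduced_simple_notin.
move=> ap; rewrite -positiveN.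
have /asboolP[c cE] := ap.
have cP i : exists d : 'I_n -> nat, val (opp_root (weyl_act (w0 D)^-1%g (simple D i)))
    = \sum_(j < n) val (simple D j) *+ d j by have /asboolP := simpleN i.
have /fin_all_exists[d dE] := cP.
apply/asboolP; exists (fun j => \sum_(i < n) d i j * c i)%N.
rewrite val_opp_root -weyl_mxP cE mulmx_sumr -sumrN.
under [RHS]eq_bigr do rewrite -sumrMnr.
rewrite [RHS]exchange_big /=; apply: eq_bigr => i _.
have := dE i; rewrite val_opp_root -weyl_mxP => E.
rewrite -scale_posz -scalemxAr -scalerN E scaler_sumr; apply: eq_bigr => j _.
by rewrite scale_posz mulrnA.
Qed.

(** The longest element makes every positive root negative, so the list of any of
its reduced words has to contain all of them. *)
Lemma inversions_w0 :
  perm_eq (inversions (reduced_word (w0 D))) [seq a <- index_enum Rt | positive a].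
Proof.
have wr := reduced_word_reduced (w0 D).
apply: uniq_perm; rewrite ?filter_uniq ?index_enum_uniq ?reduced_inversions_uniq // => a.
rewrite mem_filter mem_index_enum andbT; apply/idP/idP => [|ap].
  exact: reduced_inversions_positive.
apply: contraT => aN; have := notin_inversions ap aN.
by rewrite reduced_wordP (negPf (w0_negative ap)).
Qed.

End Words.

(** * The twisted group algebra *)

Section Twisted.
Variables (W : finGroupType) (K : fieldType) (act : W -> {rmorphism K -> K}).
Hypothesis act1 : forall p, act 1%g p = p.
Hypothesis actM : forall u v p, act (u * v)%g p = act u (act v p).
Local Notation KW := (twisted W K).
Local Notation tmul := (tmul act).
Local Notation tact := (tact act).
Implicit Types (z : KW) (u v w : W) (p c : K).

Lemma twistedP z z' : (forall w, tcoef z w = tcoef z' w) -> z = z'.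
Proof. by move=> E; apply/ffunP => w; apply: E. Qed.

Lemma tcoefD z z' w : tcoef (z + z') w = tcoef z w + tcoef z' w.
Proof. by rewrite /tcoef ffunE. Qed.

Lemma tcoefN z w : tcoef (- z) w = - tcoef z w.
Proof. by rewrite /tcoef ffunE. Qed.

Lemma tcoefB z z' w : tcoef (z - z') w = tcoef z w - tcoef z' w.
Proof. by rewrite tcoefD tcoefN. Qed.

Lemma tcoefZ c z w : tcoef (c *: z) w = c * tcoef z w.
Proof. by rewrite /tcoef ffunE. Qed.

Lemma tcoef0 w : tcoef (0 : KW) w = 0.
Proof. by rewrite /tcoef ffunE. Qed.

Lemma tcoef_sum (I : Type) (s : seq I) (P : pred I) (F : I -> KW) w :
  tcoef (\sum_(i <- s | P i) F i) w = \sum_(i <- s | P i) tcoef (F i) w.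
Proof. exact: (big_morph (fun z => tcoef z w) (fun z z' => tcoefD z z' w) (tcoef0 w)). Qed.

Lemma tcoef_delta u w : tcoef (delta K u) w = (w == u)%:R.
Proof. by rewrite /tcoef /delta ffunE. Qed.

(** The diagonal coproduct of [delta_u], in matrix coefficients. *)
Lemma tcoef_delta_diag u x y :
  (x == y)%:R * tcoef (delta K u) x = tcoef (delta K u) x * tcoef (delta K u) y.
Proof.
rewrite !tcoef_delta; have [->|xy] := eqVneq x y; first by rewrite mul1r -natrM mulnb andbb.
rewrite mul0r -natrM mulnb; have [xu|//] := eqVneq x u.
by rewrite -xu eq_sym (negPf xy).
Qed.

Lemma tcoef_tmul z z' w :
  tcoef (tmul z z') w = \sum_u tcoef z u * act u (tcoef z' (u^-1 * w)%g).
Proof.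
rewrite /Defs.tmul tcoef_sum; apply: eq_bigr => u _; rewrite tcoef_sum.
rewrite (bigD1 (u^-1 * w)%g) //= tcoefZ tcoef_delta mulKVg eqxx mulr1.
rewrite big1 ?addr0 // => v vN; rewrite tcoefZ tcoef_delta; case: eqP => [E|]; last by rewrite mulr0.
by rewrite E mulKg eqxx in vN.
Qed.

Lemma tmulA z1 z2 z3 : tmul z1 (tmul z2 z3) = tmul (tmul z1 z2) z3.
Proof.
apply: twistedP => w; rewrite !tcoef_tmul.
under eq_bigr => u _ do rewrite tcoef_tmul rmorph_sum mulr_sumr.
under [RHS]eq_bigr => v _ do rewrite tcoef_tmul mulr_suml.
rewrite [RHS]exchange_big /=; apply: eq_bigr => u _.
rewrite [RHS](reindex_inj (mulgI u)) /=; apply: eq_bigr => v _.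
by rewrite mulKg actM rmorphM mulrA invMg !mulgA.
Qed.

Lemma tmulDl z1 z2 z : tmul (z1 + z2) z = tmul z1 z + tmul z2 z.
Proof.
apply: twistedP => w; rewrite tcoefD !tcoef_tmul -big_split; apply: eq_bigr => u _.
by rewrite tcoefD mulrDl.
Qed.

Lemma tmulBl z1 z2 z : tmul (z1 - z2) z = tmul z1 z - tmul z2 z.
Proof.
apply: twistedP => w; rewrite tcoefB !tcoef_tmul -sumrB; apply: eq_bigr => u _.
by rewrite tcoefB mulrBl.
Qed.

Lemma tmulZl c z1 z : tmul (c *: z1) z = c *: tmul z1 z.
Proof.
apply: twistedP => w; rewrite tcoefZ !tcoef_tmul mulr_sumr; apply: eq_bigr => u _.
by rewrite tcoefZ mulrA.
Qed.

Lemma tmulBr z z1 z2 : tmul z (z1 - z2) = tmul z z1 - tmul z z2.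
Proof.
apply: twistedP => w; rewrite tcoefB !tcoef_tmul -sumrB; apply: eq_bigr => u _.
by rewrite tcoefB rmorphB mulrBr.
Qed.

Lemma tcoef_delta_tmul u z w : tcoef (tmul (delta K u) z) w = act u (tcoef z (u^-1 * w)%g).
Proof.
rewrite tcoef_tmul (bigD1 u) //= tcoef_delta eqxx mul1r big1 ?addr0 // => v /negPf vu.
by rewrite tcoef_delta vu mul0r.
Qed.

Lemma tcoef_tmul_scale1 z p w : tcoef (tmul z (p *: delta K 1%g)) w = tcoef z w * act w p.
Proof.
rewrite tcoef_tmul (bigD1 w) //= tcoefZ tcoef_delta mulVg eqxx mulr1 big1 ?addr0 // => u uw.
by rewrite tcoefZ tcoef_delta -eq_mulVg1 (negPf uw) mulr0 rmorph0 mulr0.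
Qed.

Lemma tmul1z z : tmul (delta K 1%g) z = z.
Proof. by apply: twistedP => w; rewrite tcoef_delta_tmul invg1 mul1g act1. Qed.

Lemma tcoef_reflection_tmul p c s z w :
  tcoef (tmul (p *: delta K 1%g + c *: delta K s) z) w =
  p * tcoef z w + c * act s (tcoef z (s^-1 * w)%g).
Proof. by rewrite tmulDl !tmulZl tmul1z tcoefD !tcoefZ tcoef_delta_tmul. Qed.

Lemma tactD z1 z2 p : tact (z1 + z2) p = tact z1 p + tact z2 p.
Proof. by rewrite /Defs.tact -big_split; apply: eq_bigr => u _; rewrite tcoefD mulrDl. Qed.

Lemma tactB z1 z2 p : tact (z1 - z2) p = tact z1 p - tact z2 p.
Proof. by rewrite /Defs.tact -sumrB; apply: eq_bigr => u _; rewrite tcoefB mulrBl. Qed.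

Lemma tactZ c z p : tact (c *: z) p = c * tact z p.
Proof. by rewrite /Defs.tact mulr_sumr; apply: eq_bigr => u _; rewrite tcoefZ mulrA. Qed.

Lemma tact_delta w p : tact (delta K w) p = act w p.
Proof.
rewrite /Defs.tact (bigD1 w) //= tcoef_delta eqxx mul1r big1 ?addr0 // => u /negPf uw.
by rewrite tcoef_delta uw mul0r.
Qed.

Lemma tact_reflection p c s x :
  tact (p *: delta K 1%g + c *: delta K s) x = p * x + c * act s x.
Proof. by rewrite tactD !tactZ !tact_delta act1. Qed.

Lemma tact_tmul z z' p : tact (tmul z z') p = tact z (tact z' p).
Proof.
rewrite /Defs.tact.
under eq_bigr => w _ do rewrite tcoef_tmul mulr_suml.
under [RHS]eq_bigr => u _ do rewrite rmorph_sum mulr_sumr.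
rewrite exchange_big /=; apply: eq_bigr => u _.
rewrite (reindex_inj (mulgI u)) /=; apply: eq_bigr => v _.
by rewrite mulKg actM rmorphM mulrA.
Qed.

Lemma twisted_basis z : z = \sum_w tcoef z w *: delta K w.
Proof.
apply: twistedP => w; rewrite tcoef_sum (bigD1 w) //= tcoefZ tcoef_delta eqxx mulr1.
by rewrite big1 ?addr0 // => u uw; rewrite tcoefZ tcoef_delta eq_sym (negPf uw) mulr0.
Qed.

(** * The dual of the twisted group algebra *)

Lemma pair_dualZr c (f : tdual W K) z : pair_dual f (c *: z) = c * pair_dual f z.
Proof. by rewrite /pair_dual linearZ. Qed.

Lemma pair_dual_sumr (f : tdual W K) (I : finType) (z : I -> KW) :
  pair_dual f (\sum_i z i) = \sum_i pair_dual f (z i).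
Proof. by rewrite /pair_dual linear_sum. Qed.

Lemma pair_dual_basis (f : tdual W K) z :
  pair_dual f z = \sum_w tcoef z w * pair_dual f (delta K w).
Proof.
by rewrite {1}(twisted_basis z) pair_dual_sumr; apply: eq_bigr => w _; rewrite pair_dualZr.
Qed.

Lemma pair_dualZ c (f : tdual W K) z : pair_dual (c *: f) z = c * pair_dual f z.
Proof. by rewrite /pair_dual lfunE. Qed.

Lemma pair_dual_sum (f : W -> tdual W K) z :
  pair_dual (\sum_w f w) z = \sum_w pair_dual (f w) z.
Proof. by rewrite /pair_dual sum_lfunE. Qed.

Lemma pair_dual_mul (f g : tdual W K) z :
  pair_dual (dual_mul f g) z =
  \sum_w tcoef z w * (pair_dual f (delta K w) * pair_dual g (delta K w)).
Proof.
pose F z : K^o := \sum_w tcoef z w * (pair_dual f (delta K w) * pair_dual g (delta K w)).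
have Flin : linear F.
  move=> c x y; rewrite /F scaler_sumr -big_split; apply: eq_bigr => w _.
  by rewrite tcoefD tcoefZ mulrDl -mulrA.
pose FL := HB.pack F (GRing.isLinear.Build _ _ _ _ F Flin) : {linear KW -> K^o}.
exact: (lfunE FL z).
Qed.

Lemma pair_bullet z (f : tdual W K) z' :
  pair_dual (bullet act z f) z' = pair_dual f (tmul z' z).
Proof.
pose F z' : K^o := pair_dual f (tmul z' z).
have Flin : linear F.
  by move=> c x y; rewrite /F tmulDl tmulZl /pair_dual linearD linearZ.
pose FL := HB.pack F (GRing.isLinear.Build _ _ _ _ F Flin) : {linear KW -> K^o}.
exact: (lfunE FL z').
Qed.

Lemma pair_dual_inj (f g : tdual W K) :
  (forall z, pair_dual f z = pair_dual g z) -> f = g.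
Proof. by move=> E; apply/lfunP. Qed.

Section DualBasis.
Variable b : W -> KW.
Hypothesis b_free : forall c : W -> K, \sum_w c w *: b w = 0 -> forall w, c w = 0.

Let X := [tuple b (enum_val i) | i < #|W|].

Lemma family_basis : basis_of fullv X.
Proof.
rewrite basisEfree subvf size_tuple; apply/andP; split; last first.
  by rewrite dimvf /dim /= muln1.
apply/freeP => c; under eq_bigr => i _ do rewrite -tnth_nth tnth_mktuple.
move=> E i; rewrite -[i]enum_valK; apply: (b_free (c := c \o enum_rank)).
rewrite (reindex_onto enum_val enum_rank) /=; last by move=> w _; rewrite enum_rankK.
rewrite -[RHS]E; apply: eq_big => [j|j _]; first by rewrite enum_valK eqxx.
by rewrite /= enum_valK.
Qed.

Lemma pair_dual_basis_coord w z :
  pair_dual (dual_basis b w) z = coord X (enum_rank w) z.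
Proof. by rewrite /pair_dual /dual_basis lfunE. Qed.

Lemma pair_dual_basisE u v : pair_dual (dual_basis b u) (b v) = (u == v)%:R.
Proof.
have -> : b v = X`_(enum_rank v).
  by rewrite -tnth_nth tnth_mktuple enum_rankK.
rewrite pair_dual_basis_coord coord_free ?(inj_eq enum_rank_inj) // 1?eq_sym //.
exact: basis_free family_basis.
Qed.

Lemma dual_eq_on_basis (f g : tdual W K) :
  (forall w, pair_dual f (b w) = pair_dual g (b w)) -> f = g.
Proof.
move=> E; apply: pair_dual_inj => z; rewrite (coord_basis family_basis (memvf z)).
rewrite !pair_dual_sumr; apply: eq_bigr => i _; rewrite !pair_dualZr.
by congr (_ * _); rewrite -tnth_nth tnth_mktuple; apply: E.
Qed.

End DualBasis.

End Twisted.

(** * The Weyl group action on the fraction field *)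

Local Notation "x %:F" := (@FracField.tofrac _ x).

Section FracMap.
Variable A : idomainType.
Implicit Types (p q : A) (x y : {fraction A}).
Local Notation repr := generic_quotient.repr.

Lemma frac_repr x : x = (\n_(repr x))%:F / (\d_(repr x))%:F.
Proof.
have d0 : \d_(repr x) != 0 by exact: denom_ratioP.
apply: (canRL (mulfK _)); first by rewrite tofrac_eq0.
rewrite -{1}[x](@generic_quotient.reprK _ {fraction A}).
set y := repr x in d0 *.
have FE z : z%:F = generic_quotient.pi {fraction A} (Ratio z 1) by unlock FracField.tofrac.
rewrite !FE -[LHS]FracField.pi_mul; apply/eqP; rewrite FracField.equivf_def /FracField.mulf.
by rewrite !numden_Ratio ?mulr1 ?oner_neq0 // mulrC.
Qed.

Variable f : {rmorphism A -> A}.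
Hypothesis f_inj : injective f.

(** Injectivity makes the extension independent of the chosen numerator and
denominator; all its algebraic properties follow from this formula. *)
Lemma frac_map_div p q : q != 0 -> frac_map f (p%:F / q%:F) = (f p)%:F / (f q)%:F.
Proof.
move=> q0; have f0 z : z != 0 -> (f z)%:F != 0.
  by rewrite tofrac_eq0 -(inj_eq f_inj) rmorph0.
have := frac_repr (p%:F / q%:F); rewrite /frac_map.
have := denom_ratioP (repr (p%:F / q%:F)).
move: (\n_(repr _)) (\d_(repr _)) => m d d0 E.
apply/eqP; rewrite eqr_div ?f0 // -!rmorphM tofrac_eq; apply/eqP; congr (f _).
apply/eqP; rewrite -tofrac_eq !rmorphM -eqr_div ?tofrac_eq0 //.
by rewrite -E.
Qed.

Lemma frac_split x : exists p q, q != 0 /\ x = p%:F / q%:F.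
Proof.
by exists \n_(repr x), \d_(repr x); split; [exact: denom_ratioP | exact: frac_repr].
Qed.

Lemma frac_map_tofrac p : frac_map f p%:F = (f p)%:F.
Proof. by rewrite -[p%:F]divr1 -tofrac1 frac_map_div ?oner_neq0 // !rmorph1 divr1. Qed.

Lemma frac_map_zmod_morphism : zmod_morphism (frac_map f).
Proof.
move=> x y; have [p [q [q0 ->]]] := frac_split x; have [p' [q' [q0' ->]]] := frac_split y.
have f0 z : z != 0 -> (f z)%:F != 0.
  by rewrite tofrac_eq0 -(inj_eq f_inj) rmorph0.
have F0 (z : A) : z != 0 -> z%:F != 0 by rewrite tofrac_eq0.
rewrite -mulNr addf_div ?F0 // -rmorphN -!rmorphM -rmorphD !frac_map_div ?mulf_neq0 //.
by rewrite -mulNr addf_div ?f0 // -rmorphN !rmorphD !rmorphM !rmorphN.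
Qed.

Lemma frac_map_monoid_morphism : monoid_morphism (frac_map f).
Proof.
split=> [|x y]; first by rewrite -tofrac1 frac_map_tofrac !rmorph1.
have [p [q [q0 ->]]] := frac_split x; have [p' [q' [q0' ->]]] := frac_split y.
rewrite mulf_div -!rmorphM !frac_map_div ?mulf_neq0 //.
by rewrite mulf_div !rmorphM.
Qed.

End FracMap.

Lemma frac_map_comp (A : idomainType) (f g k : {rmorphism A -> A}) :
    injective f -> injective g -> injective k -> (forall p, f p = g (k p)) ->
  forall x, frac_map f x = frac_map g (frac_map k x).
Proof.
move=> fi gi ki fE x; have [p [q [q0 ->]]] := frac_split x.
rewrite !frac_map_div // ?fE //.
by rewrite -(inj_eq ki) rmorph0 in q0.
Qed.

Lemma frac_map_id (A : idomainType) (f : {rmorphism A -> A}) :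
  (forall p, f p = p) -> forall x, frac_map f x = x.
Proof.
move=> fE x; have [p [q [q0 ->]]] := frac_split x.
rewrite frac_map_div ?fE //.
by move=> y z; rewrite !fE.
Qed.

Section LinearSubstitution.
Variables (R : comNzRingType) (r : nat).
Implicit Types (l : 'cV[int]_r) (M N : 'M[int]_r) (p : {mpoly R[r]}).

Lemma mpoly_morph_eq (S : nzRingType) (f g : {rmorphism {mpoly R[r]} -> S}) :
  (forall c, f c%:MP = g c%:MP) -> (forall i, f 'X_i = g 'X_i) -> f =1 g.
Proof.
move=> fgC fgX p; rewrite [p]mpolyE !rmorph_sum; apply: eq_bigr => m _.
rewrite -mul_mpolyC !rmorphM fgC mpolyXE_id !rmorph_prod; congr (_ * _).
by apply: eq_bigr => i _; rewrite !rmorphXn fgX.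
Qed.

Definition linear_form l : {mpoly R[r]} := \sum_(j < r) 'X_j *~ l j 0.

Lemma linear_formD : {morph linear_form : l l' / l + l'}.
Proof.
move=> l l'; rewrite /linear_form -big_split; apply: eq_bigr => j _.
by rewrite mxE mulrzDr.
Qed.

Lemma linear_formZ (m : int) l : linear_form (m *: l) = linear_form l *~ m.
Proof.
rewrite /linear_form (big_morph (fun x : {mpoly R[r]} => x *~ m) (mulrzDl m) (mul0rz _ m)).
by apply: eq_bigr => j _; rewrite mxE -mulrzA mulrC.
Qed.

Lemma linear_form0 : linear_form 0 = 0.
Proof. by apply: big1 => j _; rewrite mxE mulr0z. Qed.

Lemma linear_form_delta j : linear_form (delta_mx j 0) = 'X_j.
Proof.
rewrite /linear_form (bigD1 j) //= mxE !eqxx mulr1z big1 ?addr0 // => i /negPf ij.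
by rewrite mxE ij mulr0z.
Qed.

Lemma linear_form_coef l j : (linear_form l)@_U_(j) = (l j 0)%:~R.
Proof.
rewrite /linear_form raddf_sum (bigD1 j) //= big1 => [|i /negPf ij].
  by rewrite raddfMz /= mcoeffXU eqxx addr0.
by rewrite raddfMz /= mcoeffXU ij mul0rz.
Qed.

Lemma linear_form_coef0 l : (linear_form l)@_0%MM = 0.
Proof.
rewrite /linear_form raddf_sum big1 // => j _.
by rewrite raddfMz /= mcoeffX mnm1_eq0 mul0rz.
Qed.

Definition linear_subst M : {rmorphism {mpoly R[r]} -> {mpoly R[r]}} :=
  comp_mpoly [tuple linear_form (col j M) | j < r].

Lemma linear_substC M c : linear_subst M c%:MP = c%:MP.
Proof. exact: comp_mpolyC. Qed.

Lemma linear_subst_form M l : linear_subst M (linear_form l) = linear_form (M *m l).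
Proof.
have -> : M *m l = \sum_j l j 0 *: col j M.
  apply/colP => i; rewrite mxE summxE; apply: eq_bigr => j _.
  by rewrite !mxE mulrC.
rewrite (big_morph _ linear_formD linear_form0) rmorph_sum; apply: eq_bigr => j _.
by rewrite rmorphMz linear_formZ /= comp_mpolyXU nth_mktuple.
Qed.

Lemma linear_subst_mul M N p :
  linear_subst (M *m N) p = linear_subst M (linear_subst N p).
Proof.
rewrite -[RHS]/((linear_subst M \o linear_subst N) p).
move: p; apply: mpoly_morph_eq => [c|j]; rewrite -[RHS]/(linear_subst M (linear_subst N _)).
  by rewrite !linear_substC.
by rewrite -linear_form_delta !linear_subst_form mulmxA.
Qed.

Lemma linear_subst1 p : linear_subst 1%:M p = p.
Proof.
rewrite -[RHS]/(idfun p); move: p; apply: mpoly_morph_eq => [c|j].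
  by rewrite linear_substC.
by rewrite -linear_form_delta linear_subst_form mul1mx.
Qed.

End LinearSubstitution.

Section WeylAction.
Variables (r n : nat) (D : semisimple_datum r n).
Local Notation Rt := (roots D).
Local Notation W := (weyl D).
Implicit Types (l : 'cV[int]_r) (u v w : W).

Definition actS_morph w : {rmorphism Sa r -> Sa r} :=
  GRing.RMorphism.clone (Sa r) (Sa r) (actS w) (linear_subst {poly int} (weyl_mx w)).

Lemma actS_mul u v p : actS_morph (u * v)%g p = actS_morph u (actS_morph v p).
Proof.
have := @linear_subst_mul {poly int} r (weyl_mx u) (weyl_mx v) p.
rewrite -weyl_mxM; exact.
Qed.

Lemma actS1 p : actS_morph 1%g p = p.
Proof.
have := @linear_subst1 {poly int} r p.
rewrite -(@weyl_mx1 r n D); exact.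
Qed.

Lemma actS_inj w : injective (actS_morph w).
Proof. by apply: (can_inj (g := actS_morph w^-1%g)) => p; rewrite -actS_mul mulVg actS1. Qed.

Definition actQ_morph w : {rmorphism Qa r -> Qa r} :=
  HB.pack (actQ w)
    (GRing.isZmodMorphism.Build _ _ (actQ w) (frac_map_zmod_morphism (@actS_inj w)))
    (GRing.isMonoidMorphism.Build _ _ (actQ w) (frac_map_monoid_morphism (@actS_inj w))).

Lemma actQ_mul u v (x : Qa r) : actQ_morph (u * v)%g x = actQ_morph u (actQ_morph v x).
Proof. exact: (frac_map_comp (@actS_inj _) (@actS_inj _) (@actS_inj _) (actS_mul u v)). Qed.

Lemma actQ1 (x : Qa r) : actQ_morph 1%g x = x.
Proof. exact: (frac_map_id actS1). Qed.

Lemma actQ_lin w l : actQ_morph w (linQ l) = linQ (weyl_mx w *m l).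
Proof.
apply: etrans (frac_map_tofrac (@actS_inj w) _) _.
congr (_ %:F); exact: (@linear_subst_form {poly int} r (weyl_mx w) l).
Qed.

Lemma actQ_h w : actQ_morph w (hQ r) = hQ r.
Proof.
apply: etrans (frac_map_tofrac (@actS_inj w) _) _.
congr (_ %:F); exact: (@linear_substC {poly int} r (weyl_mx w) 'X).
Qed.

Lemma linQB l l' : linQ (l - l') = linQ l - linQ l'.
Proof.
rewrite -[RHS](@rmorphB (Sa r) (Qa r) (@FracField.tofrac (Sa r)) (linS l) (linS l')).
congr (_ %:F); have := @linear_formD {poly int} r l (- l').
rewrite -[- l']scaleN1r linear_formZ mulrN1z; exact.
Qed.

Lemma linQZ (m : int) l : linQ (m *: l) = m%:~R * linQ l.
Proof.
rewrite mulrzl -[RHS](@rmorphMz (Sa r) (Qa r) (@FracField.tofrac (Sa r)) m (linS l)).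
congr (_ %:F); exact: (@linear_formZ {poly int} r m l).
Qed.

Lemma linQ_inj : injective (@linQ r).
Proof.
move=> l l' /eqP; rewrite tofrac_eq => /eqP E; apply/colP => j.
have : (linear_form {poly int} l)@_U_(j) = (linear_form {poly int} l')@_U_(j).
  by congr (_ @_ _).
rewrite !linear_form_coef => /(congr1 (coefp 0)) /=.
by rewrite !coefMrz coef1 /= !intz.
Qed.

Lemma h_sub_linQ_neq0 l : hQ r - linQ l != 0.
Proof.
rewrite -[hQ r - _](@rmorphB (Sa r) (Qa r) (@FracField.tofrac (Sa r)) (mpolyC r 'X) (linS l)).
rewrite tofrac_eq0; apply/eqP => E.
have : (mpolyC r ('X : {poly int}) - linear_form {poly int} l)@_0%MM = 0.
  by rewrite -[RHS](mcoeff0 _ (0%MM : 'X_{1..r})); congr (_ @_ _).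
by rewrite mcoeffB mcoeffC eqxx mulr1 linear_form_coef0 subr0 => /eqP; rewrite polyX_eq0.
Qed.

End WeylAction.

(** * Demazure-Lusztig elements *)

(** The properties of [Q^a] that the argument uses: a field on which [W] acts, an
equivariant embedding of the lattice, and an invariant element [h] outside its
image. Stating them abstractly keeps polynomials and fractions out of the
computations with Demazure-Lusztig elements. *)
Record realization (r n : nat) (D : semisimple_datum r n) (K : fieldType) := Realization {
  ract :> weyl D -> {rmorphism K -> K};
  rlin : 'cV[int]_r -> K;
  rh : K;
  ract1 : forall p, ract 1%g p = p;
  ractM : forall u v p, ract (u * v)%g p = ract u (ract v p);
  ract_lin : forall w l, ract w (rlin l) = rlin (weyl_mx w *m l);
  ract_h : forall w, ract w rh = rh;
  rlinB : forall l l', rlin (l - l') = rlin l - rlin l';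
  rlinZ : forall (m : int) l, rlin (m *: l) = m%:~R * rlin l;
  rlin_inj : injective rlin;
  rh_sub_neq0 : forall l, rh - rlin l != 0 }.

Section Demazure.
Variables (r n : nat) (D : semisimple_datum r n) (K : fieldType) (A : realization D K).
Local Notation Rt := (roots D).
Local Notation W := (weyl D).
Local Notation lin := (rlin A).
Local Notation h := (rh A).
Local Notation KW := (twisted W K).
Local Notation act := (fun w : W => GRing.RMorphism.sort (ract A w)).
Local Notation "x ** y" := (tmul act x y) (at level 40, left associativity).
Local Notation wprod := (word_prod D).
Local Notation s_ := (simple_refl D).
Implicit Types (I J : seq 'I_n) (i : 'I_n) (w u v : W) (z : KW) (l : 'cV[int]_r) (a : Rt).

Let tmulA := tmulA (ractM A).
Let tmul1z := tmul1z (@ract1 _ _ _ _ A).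
Let tmulBl := tmulBl A.
Let tmulBr := tmulBr A.
Let tactZ := tactZ A.
Let tactB := tactB A.
Let tact_delta := tact_delta A.
Let tcoef_tmul_scale1 := tcoef_tmul_scale1 A.
Let tact_tmul := tact_tmul (ractM A).

Definition alpha i : K := lin (val (simple D i)).

Definition T_gen i : KW :=
  - (h / alpha i) *: delta K 1%g + ((h - alpha i) / alpha i) *: delta K (s_ i).

Definition T_word I : KW := \big[tmul act/delta K 1%g]_(i <- I) T_gen i.

Lemma lin_root_neq0 a : lin (val a) != 0.
Proof.
have lin0 : lin 0 = 0 by rewrite -(scale0r (0 : 'cV[int]_r)) rlinZ mul0r.
by apply: contra (root_neq0 a) => /eqP E; apply/eqP/(@rlin_inj _ _ _ _ A); rewrite E lin0.
Qed.

Lemma alpha_neq0 i : alpha i != 0.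
Proof. exact: lin_root_neq0. Qed.

Lemma hat_alpha_neq0 i : h - alpha i != 0.
Proof. exact: rh_sub_neq0. Qed.

Lemma T_word_nil : T_word [::] = delta K 1%g.
Proof. by rewrite /T_word big_nil. Qed.

Lemma T_word_cons i J : T_word (i :: J) = T_gen i ** T_word J.
Proof. by rewrite /T_word big_cons. Qed.

Lemma T_word_cat I J : T_word (I ++ J) = T_word I ** T_word J.
Proof.
elim: I => [|i I IHI] /=; first by rewrite T_word_nil tmul1z.
by rewrite !T_word_cons IHI tmulA.
Qed.

Lemma tcoef_T_gen_tmul i z w :
  tcoef (T_gen i ** z) w =
  - (h / alpha i) * tcoef z w + (h - alpha i) / alpha i * A (s_ i) (tcoef z (s_ i * w)%g).
Proof.
rewrite /T_gen; have := tcoef_reflection_tmul (@ract1 _ _ _ _ A) (- (h / alpha i)) ((h - alpha i) / alpha i) (s_ i) z w.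
by rewrite simple_reflV.
Qed.

Lemma lin_simple_refl i l :
  lin (weyl_mx (s_ i) *m l) = lin l - (pairing (coroot (simple D i)) l)%:~R * alpha i.
Proof. by rewrite weyl_mx_simple rlinB rlinZ. Qed.

Lemma T_gen_tact1 i : tact act (T_gen i) 1 = -1.
Proof.
apply: etrans (tact_reflection (@ract1 _ _ _ _ A) _ _ _ _) _; rewrite rmorph1 2!mulr1.
by have := alpha_neq0 i; move: (alpha i) => a a0; field.
Qed.

(** The commutation rule of the degenerate affine Hecke algebra. *)
Lemma T_gen_lin i l z :
  T_gen i ** (lin l *: z) =
  lin (weyl_mx (s_ i) *m l) *: (T_gen i ** z)
  - (h * (pairing (coroot (simple D i)) l)%:~R) *: z.
Proof.
apply: twistedP => w; rewrite tcoefB tcoef_T_gen_tmul.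
rewrite [tcoef (lin l *: z) w]tcoefZ.
rewrite [tcoef (lin l *: z) _]tcoefZ.
rewrite [tcoef (_ *: z) w]tcoefZ.
rewrite [tcoef (_ *: _) w]tcoefZ tcoef_T_gen_tmul.
rewrite rmorphM.
rewrite ract_lin.
rewrite lin_simple_refl; have := alpha_neq0 i; move: (alpha i) => a a0; field.
exact: a0.
Qed.

Lemma T_word_tact1 I : tact act (T_word I) 1 = (-1) ^+ odd (size I).
Proof.
elim: I => [|i I IHI]; first by rewrite T_word_nil tact_delta ract1.
rewrite T_word_cons tact_tmul IHI /= /tact; case: odd => /=; rewrite ?expr0 ?expr1.
  under eq_bigr do rewrite rmorphN mulrN.
  by rewrite sumrN [X in - X]T_gen_tact1 opprK.
exact: T_gen_tact1.
Qed.

(** The words got from [I] by erasing one letter, with the coefficient that each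
picks up when [lin l] is moved through [T_word I] from right to left. *)
Fixpoint deletions I l : seq (int * seq 'I_n) :=
  if I is i :: J then
    (pairing (coroot (simple D i)) (weyl_mx (wprod J) *m l), J)
      :: [seq (p.1, i :: p.2) | p <- deletions J l]
  else [::].

Lemma size_deletions I l p : p \in deletions I l -> (size p.2).+1 = size I.
Proof.
elim: I p => [//|i J IHJ] p /=; rewrite inE => /predU1P[-> //|/mapP[q /IHJ E ->]].
by rewrite /= E.
Qed.

Lemma T_word_lin I l :
  T_word I ** (lin l *: delta K 1%g) =
  lin (weyl_mx (wprod I) *m l) *: T_word I
  - h *: \sum_(p <- deletions I l) p.1%:~R *: T_word p.2.
Proof.
elim: I => [|i J IHJ] /=.
  rewrite big_nil scaler0 subr0 T_word_nil word_prod_nil weyl_mx1 mul1mx tmul1z.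
  by [].
have E : h *: \sum_(p <- deletions (i :: J) l) p.1%:~R *: T_word p.2
  = (h * (pairing (coroot (simple D i)) (weyl_mx (wprod J) *m l))%:~R) *: T_word J
    + T_gen i ** (h *: \sum_(p <- deletions J l) p.1%:~R *: T_word p.2).
  rewrite /= big_cons scalerDr scalerA big_map; congr (_ + _).
  set dl := deletions J l.
  apply: twistedP => w; rewrite tcoef_T_gen_tmul !tcoefZ rmorphM ract_h !tcoef_sum rmorph_sum.
  rewrite !mulr_sumr -big_split; apply: eq_bigr => p _ /=.
  rewrite !tcoefZ T_word_cons tcoef_T_gen_tmul rmorphM rmorph_int.
  move: (p.1%:~R) (_ / _) (_ / _) => c d e; ring.
rewrite T_word_cons -tmulA IHJ tmulBr T_gen_lin -addrA -opprD -E.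
by rewrite word_prod_cons weyl_mxM mulmxA.
Qed.

(** The total coefficient with which an element [v] arises from erasing a letter in
a word for [w] depends on [w] only: up to the factor 4, it is a sum over the
roots [a] whose reflection leads from [w] to [v], weighted by the change of sign
of [a] under [w]. Prepending [s_i] changes only the signs of the roots that [w]
sends to [alpha_i] or its opposite, which is the term added by the new letter. *)
Lemma deletions_sum I l v :
  \sum_(p <- deletions I l) (if wprod p.2 == v then 4 * p.1 else 0) =
  \sum_a (if weyl_mx (wprod I) *m reflect_mx a == weyl_mx v then
            (sgn_root a - sgn_root (weyl_act (wprod I) a)) * pairing (coroot a) l else 0).
Proof.
elim: I v => [|i J IHJ] v /=.
  rewrite big_nil big1 // => a _; rewrite word_prod_nil weyl_act1 subrr mul0r; exact: if_same.
set u := wprod J.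
have mxE w x : (weyl_mx (s_ i * w)%g *m x == weyl_mx v) = (weyl_mx w *m x == weyl_mx (s_ i * v)%g).
  rewrite !weyl_mxM; apply/eqP/eqP => [<-|].
    by rewrite !mulmxA -weyl_mxM simple_reflK weyl_mx1 mul1mx.
  by move=> E; rewrite -mulmxA E mulmxA -weyl_mxM simple_reflK weyl_mx1 mul1mx.
have gE w : ((s_ i * w)%g == v) = (w == (s_ i * v)%g).
  by apply/eqP/eqP => [<-|->]; rewrite simple_reflKl.
rewrite big_cons big_map /= word_prod_cons.
under eq_bigr do rewrite word_prod_cons gE.
rewrite IHJ -/u; apply/eqP; rewrite eq_sym -subr_eq -sumrB; apply/eqP.
set si := simple D i; set al := pairing (coroot si) _.
pose F b : int := if reflect_mx b *m weyl_mx u == weyl_mx (s_ i * v)%g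
  then (sgn_root b - sgn_root (reflect_root si b)) * pairing (coroot b) (weyl_mx u *m l) else 0.
transitivity (\sum_b F b).
  rewrite [RHS](reindex_inj (can_inj (weyl_actK u))); apply: eq_bigr => a _.
  rewrite mxE /F -reflect_mx_conj.
  case: ifP => _; last by rewrite subr0.
  rewrite weyl_actM simple_refl_act -mulrBl opprB addrC addrA subrK; congr (_ * _).
  by rewrite /pairing mulmxA coroot_act.
have siN : opp_root si != si.
  by rewrite eq_sym; apply: simple_opp_positive; apply: simple_positive.
rewrite (bigD1 si) //= (bigD1 (opp_root si)) //= big1 ?addr0 => [|b /andP[b1 b2]]; last first.
  by rewrite /F sgn_root_reflect (negPf b1) (negPf b2) !mulr0n !subr0 subrr mul0r if_same.
rewrite /F reflect_mx_opp -weyl_mx_refl -weyl_mxM (inj_eq (@weyl_mx_inj _ _ _)) (can_eq (simple_reflKl i)).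
case: ifP => _; last by rewrite addr0.
rewrite !sgn_root_reflect !eqxx [si == _]eq_sym (negPf siN) -/si.
by rewrite coroot_opp pairingNl -/al /sgn_root simple_positive !mulr1n !mulr0n; ring.
Qed.

(** Induction on the length: moving linear forms through the difference of the two
products shows that it is a multiple of one [delta_w], and its action on 1 shows
that this multiple is zero. *)
Theorem T_word_unique I J : wprod I = wprod J -> T_word I = T_word J.
Proof.
suff H N : forall I J, (size I <= N)%N -> (size J <= N)%N -> wprod I = wprod J ->
    T_word I = T_word J.
  by apply: (H (maxn (size I) (size J))); rewrite ?leq_maxl ?leq_maxr.
elim: N {I J} => [|N IHN] I J.
  by rewrite !leqn0 !size_eq0 => /eqP-> /eqP->.
move=> sI sJ IJ; set w := wprod I in IJ.
have comm B : (size B <= N.+1)%N -> wprod B = w -> forall l,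
    T_word B ** (lin l *: delta K 1%g) = lin (weyl_mx w *m l) *: T_word B
    - h *: \sum_v (\sum_(p <- deletions B l) (if wprod p.2 == v then p.1 else 0))%:~R
           *: T_word (reduced_word v).
  move=> sB pB l; rewrite T_word_lin pB; congr (_ - _ *: _).
  under [RHS]eq_bigr do rewrite raddf_sum scaler_suml.
  rewrite exchange_big /= !big_seq; apply: eq_bigr => p /size_deletions sp.
  rewrite (bigD1 (wprod p.2)) //= eqxx big1 ?addr0 => [|v /negPf vp]; last first.
    by rewrite eq_sym vp mulr0z scale0r.
  have sp2 : (size p.2 <= N)%N by rewrite -ltnS sp.
  congr (_ *: _); apply: IHN; rewrite ?reduced_wordP //.
  by rewrite size_tuple (leq_trans (wlen_word D _)).
(* [deletions_sum] determines the coefficients after multiplication by 4. *)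
have deletions_eq l v : \sum_(p <- deletions I l) (if wprod p.2 == v then p.1 else 0)
    = \sum_(p <- deletions J l) (if wprod p.2 == v then p.1 else 0).
  apply: (@mulfI _ (4 : int)) => //; rewrite !mulr_sumr.
  have := deletions_sum I l v; rewrite -/w IJ -deletions_sum.
  under eq_bigr do rewrite -[0](mulr0 (4 : int)) -fun_if.
  by under [RHS]eq_bigr do rewrite -[0](mulr0 (4 : int)) -fun_if.
set d := T_word I - T_word J.
have dl l : d ** (lin l *: delta K 1%g) = lin (weyl_mx w *m l) *: d.
  rewrite tmulBl !comm //; under [X in _ - h *: X - _]eq_bigr do rewrite deletions_eq.
  by rewrite opprB addrA subrK scalerBr.
(* Distinct elements of [W] act differently on some linear form, so [dl] leaves
  only the coefficient at [w]. *)
have dE : d = tcoef d w *: delta K w.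
  apply: twistedP => v; rewrite [RHS]tcoefZ tcoef_delta.
  have [->|vw] := eqVneq v w; first by rewrite mulr1.
  rewrite mulr0; apply: contraTeq vw => dv0; rewrite negbK; apply/eqP/weyl_mx_inj.
  apply/matrixP => i j; have := tcoef_tmul_scale1 d (lin (delta_mx j 0)) v.
  rewrite dl ract_lin [LHS]tcoefZ mulrC => /(mulfI dv0)/rlin_inj/colP/(_ i).
  by rewrite -!colE !mxE.
have : tact act d 1 = 0.
  by rewrite tactB !T_word_tact1 (word_parity IJ) subrr.
rewrite dE tactZ tact_delta rmorph1 mulr1 => d0.
by apply/eqP; rewrite -subr_eq0 -/d dE d0 scale0r.
Qed.

End Demazure.

(** * Stable classes as a dual basis *)

Section Stable.
Variables (r n : nat) (D : semisimple_datum r n) (K : fieldType) (A : realization D K).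
Local Notation Rt := (roots D).
Local Notation W := (weyl D).
Local Notation lin := (rlin A).
Local Notation h := (rh A).
Local Notation KW := (twisted W K).
Local Notation act := (fun w : W => GRing.RMorphism.sort (ract A w)).
Local Notation "x ** y" := (tmul act x y) (at level 40, left associativity).
Local Notation wprod := (word_prod D).
Local Notation s_ := (simple_refl D).
Local Notation alpha := (alpha A).
Local Notation T_gen := (T_gen A).
Local Notation T_word := (T_word A).
Implicit Types (I J : seq 'I_n) (i : 'I_n) (w u v : W) (z : KW) (l : 'cV[int]_r) (a : Rt).

Definition T_elt w : KW := T_word (reduced_word w).

Lemma T_word_elt I : T_word I = T_elt (wprod I).
Proof. by apply: T_word_unique; rewrite reduced_wordP. Qed.

Lemma T_elt_mul u v : T_elt u ** T_elt v = T_elt (u * v)%g.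
Proof.
have E : wprod (reduced_word u ++ reduced_word v) = (u * v)%g.
  by rewrite word_prod_cat; congr (_ * _)%g; apply: reduced_wordP.
by have := T_word_elt (reduced_word u ++ reduced_word v); rewrite E T_word_cat.
Qed.

(** Expanding [T_word I] gives the products of the subwords of [I]; an element at
least as long as [I] can only come from [I] itself, through the terms in
[delta] of all the factors. *)
Lemma tcoef_T_word I w : (size I <= wlen w)%N ->
  tcoef (T_word I) w =
  (wprod I == w)%:R * \prod_(a <- inversions D I) ((h - lin (val a)) / lin (val a)).
Proof.
elim: I w => [|i J IHJ] w /= sI.
  by rewrite T_word_nil tcoef_delta word_prod_nil big_nil mulr1 eq_sym.
have sJ : (size J <= wlen (s_ i * w)%g)%N.
  have le := wlen_simple_mul i (s_ i * w)%g; rewrite (simple_reflKl i w) in le.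
  exact: leq_trans sI le.
have nw : (wprod J == w) = false.
  by apply: contraTF sI => /eqP <-; rewrite -leqNgt wlen_word.
have wE : (wprod (i :: J) == w) = (wprod J == (s_ i * w)%g).
  by rewrite word_prod_cons -(can_eq (simple_reflKl i)) simple_reflKl.
rewrite wE T_word_cons tcoef_T_gen_tmul.
move: (s_ i * w)%g sJ {wE} => w' sJ.
rewrite (IHJ w (ltnW sI)) nw mul0r mulr0 add0r (IHJ w' sJ) rmorphM rmorph_nat.
rewrite big_cons big_map rmorph_prod mulrCA; congr (_ * (_ * _)).
apply: eq_bigr => a _; rewrite fmorph_div rmorphB ract_h ract_lin.
by rewrite weyl_mxP simple_refl_act.
Qed.

Definition pos_prod : K := \prod_(a : Rt | positive a) lin (val a).
Definition hat_pos_prod : K := \prod_(a : Rt | positive a) (h - lin (val a)).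

Lemma pos_prod_neq0 : pos_prod != 0.
Proof. by apply/prodf_neq0 => a _; apply: lin_root_neq0. Qed.

Lemma hat_pos_prod_neq0 : hat_pos_prod != 0.
Proof. by apply/prodf_neq0 => a _; apply: rh_sub_neq0. Qed.

Lemma tcoef_T_elt_w0 w :
  tcoef (T_elt w) (w0 D) = (w == w0 D)%:R * (hat_pos_prod / pos_prod).
Proof.
rewrite tcoef_T_word ?size_tuple ?wlen_w0 // reduced_wordP.
have [->|_] := eqVneq; last by rewrite !mul0r.
rewrite !mul1r (perm_big _ (inversions_w0 D)) big_filter /=.
by rewrite big_split prodfV.
Qed.

Lemma delta_free (c : W -> K) : \sum_w c w *: delta K w = 0 -> forall w, c w = 0.
Proof.
move=> c0 w; have := congr1 (fun z => tcoef z w) c0.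
rewrite tcoef0 tcoef_sum (bigD1 w) //= big1 => [|v vw].
  by rewrite addr0 [LHS]tcoefZ tcoef_delta eqxx mulr1.
by rewrite [LHS]tcoefZ tcoef_delta eq_sym (negPf vw) mulr0.
Qed.

Lemma pair_dual_delta w z : pair_dual (dual_basis (@delta W K) w) z = tcoef z w.
Proof.
rewrite pair_dual_basis (bigD1 w) //= big1 => [|v vw].
  by rewrite pair_dual_basisE ?eqxx ?mulr1 ?addr0 //; apply: delta_free.
by rewrite pair_dual_basisE ?(negPf vw) ?mulr0 1?eq_sym ?(negPf vw) ?mulr0 //; apply: delta_free.
Qed.

Definition stable_class w : tdual W K :=
  (-1) ^+ wlen (w0 D) *:
    bullet act (T_elt (w^-1 * w0 D)%g) (pos_prod *: dual_basis (@delta W K) (w0 D)).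

Definition stable_scale : K := (-1) ^+ wlen (w0 D) * hat_pos_prod.

Lemma stable_scale_neq0 : stable_scale != 0.
Proof. by rewrite mulf_neq0 ?signr_eq0 ?hat_pos_prod_neq0. Qed.

(** [T_v T_(u^-1 w0) = T_(v u^-1 w0)] has a nonzero coefficient at the longest
element only for [v = u]. *)
Lemma pair_stable_class u v :
  pair_dual (stable_class u) (T_elt v) = stable_scale *+ (u == v).
Proof.
rewrite pair_dualZ pair_bullet pair_dualZ pair_dual_delta T_elt_mul tcoef_T_elt_w0.
have -> (G : finGroupType) (x y z : G) : (x * (y^-1 * z) == z)%g = (y == x).
  by rewrite mulgA -[RHS](inj_eq (mulIg (y^-1 * z)%g)) mulVKg mulgA eq_sym.
case: eqP => _; last by rewrite mul0r !mulr0.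
by rewrite mul1r [pos_prod * _]mulrC divfK ?pos_prod_neq0.
Qed.

(** The stable classes pair with the [T_w] by an invertible diagonal matrix. *)
Lemma T_elt_free (c : W -> K) : \sum_w c w *: T_elt w = 0 -> forall w, c w = 0.
Proof.
move=> c0 w; have : pair_dual (stable_class w) (\sum_v c v *: T_elt v) = 0.
  by rewrite c0 /pair_dual linear0.
rewrite pair_dual_sumr (bigD1 w) //= big1 => [|v vw].
  rewrite addr0 pair_dualZr pair_stable_class eqxx => /eqP.
  by rewrite mulf_eq0 (negPf stable_scale_neq0) orbF => /eqP.
by rewrite pair_dualZr pair_stable_class eq_sym (negPf vw) mulr0.
Qed.

Lemma stable_class_dual w : stable_class w = stable_scale *: dual_basis T_elt w.
Proof.
apply: (dual_eq_on_basis T_elt_free) => v.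
rewrite pair_stable_class pair_dualZ pair_dual_basisE; last exact: T_elt_free.
by rewrite mulr_natr.
Qed.

(** * The coproduct of a Demazure-Lusztig element *)

(** The operator [B_j] of a position with letter [i], where [e] and [f] say whether
the position belongs to [E] and to [F]. *)
Definition coprod_gen i (e f : bool) : KW :=
  let a := alpha i in
  let d := delta K (s_ i) in
  if e && f then (a / (h - a)) *: d
  else if e || f then (h / (h - a)) *: d
  else - (h / a) *: delta K 1%g + (h ^+ 2 / (a * (h - a))) *: d.

Definition coprod_coef k (I : k.-tuple 'I_n) (E F : {set 'I_k}) : K :=
  tact act (\big[tmul act/delta K 1%g]_(j < k) coprod_gen (tnth I j) (j \in E) (j \in F)) 1.

Definition cons_set k (b : bool) (E : {set 'I_k}) : {set 'I_k.+1} :=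
  [set j | if unlift ord0 j is Some j' then j' \in E else b].

Lemma mem_cons_set0 k b (E : {set 'I_k}) : (ord0 \in cons_set b E) = b.
Proof. by rewrite inE unlift_none. Qed.

Lemma mem_cons_setS k b (E : {set 'I_k}) j : (lift ord0 j \in cons_set b E) = (j \in E).
Proof. by rewrite inE liftK. Qed.

Lemma sum_cons_set k (V : nmodType) (G : {set 'I_k.+1} -> V) :
  \sum_E G E = \sum_(E : {set 'I_k}) \sum_(b : bool) G (cons_set b E).
Proof.
rewrite pair_big /=.
rewrite (reindex (fun p : {set 'I_k} * bool => cons_set p.2 p.1)) //=.
exists (fun E : {set 'I_k.+1} => ([set j : 'I_k | lift ord0 j \in E], ord0 \in E)) => [[E b] _|E _] /=.
  by rewrite mem_cons_set0; congr (_, _); apply/setP => j; rewrite inE mem_cons_setS.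
by apply/setP => j; rewrite inE; case: unliftP => [j' ->|->]; rewrite ?inE.
Qed.

Lemma subword_cons k i (J : k.-tuple 'I_n) b (E : {set 'I_k}) :
  subword [tuple of i :: J] (cons_set b E) = nseq b i ++ subword J E.
Proof.
have enumE m (B : {set 'I_m}) : enum B = [seq j <- enum 'I_m | j \in B] by rewrite enumT.
rewrite /subword !enumE enum_ordSl /= mem_cons_set0 filter_map.
have -> : [seq x <- enum 'I_k | preim (lift ord0) (fun j => j \in cons_set b E) x]
    = [seq j <- enum 'I_k | j \in E].
  by apply: eq_filter => j; rewrite /= mem_cons_setS.
by case: b; rewrite /= -map_comp; [congr (_ :: _)|]; apply: eq_map => j; rewrite /= tnthS.
Qed.

Lemma tact_reflection1 p c i x :
  tact act (p *: delta K 1%g + c *: delta K (s_ i)) x = p * x + c * A (s_ i) x.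
Proof. exact: (tact_reflection (@ract1 _ _ _ _ A)). Qed.

Lemma coprod_coef_cons k i (J : k.-tuple 'I_n) b c (E F : {set 'I_k}) :
  let a := alpha i in
  coprod_coef [tuple of i :: J] (cons_set b E) (cons_set c F) =
  (- (h / a) * coprod_coef J E F) *+ ~~ (b || c)
  + (if b && c then a / (h - a) else if b || c then h / (h - a) else h ^+ 2 / (a * (h - a)))
    * A (s_ i) (coprod_coef J E F).
Proof.
move=> a; rewrite {1}/coprod_coef big_ord_recl tnth0 !mem_cons_set0.
have -> : \big[tmul act/delta K 1%g]_(j < k) coprod_gen (tnth [tuple of i :: J] (lift ord0 j))
      (lift ord0 j \in cons_set b E) (lift ord0 j \in cons_set c F)
    = \big[tmul act/delta K 1%g]_(j < k) coprod_gen (tnth J j) (j \in E) (j \in F).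
  by apply: eq_bigr => j _; rewrite !mem_cons_setS tnthS.
apply: etrans (tact_tmul (@ractM _ _ _ _ A) _ _ _) _.
rewrite -/(coprod_coef J E F); move: (coprod_coef J E F) => q.
case: b; case: c; rewrite ?mulr0n ?mulr1n ?add0r;
  first [exact: tact_reflection1 | exact: (etrans (tactZ A _ _ _) (congr1 _ (tact_delta A _ _)))].
Qed.

(** In terms of matrix coefficients: the diagonal coproduct [delta_w |-> delta_w (x)
delta_w] maps [T_word I] to the sum of the [T_(I|E) (x) T_(I|F)] with these
coefficients. Prepending a letter [i] multiplies by [T_i], in which
[delta_i] acts on both tensor factors and is itself
[(alpha / (h - alpha)) T_i + h / (h - alpha)]. *)
Lemma coproduct_T_word k (I : k.-tuple 'I_n) (x y : W) :
  (x == y)%:R * tcoef (T_word I) x =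
  \sum_E \sum_F coprod_coef I E F
    * tcoef (T_word (subword I E)) x * tcoef (T_word (subword I F)) y.
Proof.
elim: k I x y => [|k IHk] I x y.
  rewrite (tuple0 I) (big_pred1 set0) => [|E]; last first.
    by apply/esym/eqP/setP => -[].
  rewrite (big_pred1 set0) => [|E]; last by apply/esym/eqP/setP => -[].
  rewrite /coprod_coef big_ord0 (tact_delta A) rmorph1 mul1r /subword enum_set0 /=.
  by rewrite T_word_nil; apply: tcoef_delta_diag.
case/tupleP: I => i J.
have -> : T_word [tuple of i :: J] = T_gen i ** T_word J by apply: T_word_cons.
have step w (b : bool) L : tcoef (T_word (nseq b i ++ L)) w =
    if b then - (h / alpha i) * tcoef (T_word L) w
      + (h - alpha i) / alpha i * A (s_ i) (tcoef (T_word L) (s_ i * w)%g)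
    else tcoef (T_word L) w.
  by case: b => //=; rewrite T_word_cons tcoef_T_gen_tmul.
have xy : (x == y) = (s_ i * x == s_ i * y)%g by rewrite (can_eq (simple_reflKl i)).
rewrite tcoef_T_gen_tmul mulrDr mulrCA IHk mulrCA [in X in _ + X]xy.
move: (s_ i * x)%g (s_ i * y)%g (step x) (step y) => x' y' stepx stepy.
rewrite -(rmorph_nat (A (s_ i))) -rmorphM IHk {xy}.
rewrite sum_cons_set rmorph_sum !mulr_sumr -big_split; apply: eq_bigr => E _.
rewrite big_bool !sum_cons_set -big_split rmorph_sum !mulr_sumr -big_split.
apply: eq_bigr => F _.
rewrite !big_bool !subword_cons !stepx !stepy !coprod_coef_cons /= !rmorphM.
have := alpha_neq0 A i; have := hat_alpha_neq0 A i; rewrite !mulr0n mulr1n.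
move: (alpha i) (coprod_coef _ _ _) (A _ (coprod_coef _ _ _)) => a p p' ha a0.
move: (A _ (tcoef _ x')) (A _ (tcoef _ y')) (tcoef _ x) (tcoef _ y) => X' Y' X Y.
by field; rewrite ha a0.
Qed.

Lemma pair_dual_mul_T_word k (I : k.-tuple 'I_n) (f g : tdual W K) :
  pair_dual (dual_mul f g) (T_word I) =
  \sum_E \sum_F coprod_coef I E F
    * pair_dual f (T_word (subword I E)) * pair_dual g (T_word (subword I F)).
Proof.
rewrite pair_dual_mul.
transitivity (\sum_x \sum_y (x == y)%:R * tcoef (T_word I) x
    * (pair_dual f (delta K x) * pair_dual g (delta K y))).
  apply: eq_bigr => x _; rewrite (bigD1 x) //= eqxx mul1r big1 ?addr0 // => y /negPf yx.
  by rewrite eq_sym yx !mul0r.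
under eq_bigr => x _ do under eq_bigr => y _ do rewrite coproduct_T_word mulr_suml.
under eq_bigr do rewrite exchange_big /=.
rewrite exchange_big; apply: eq_bigr => E _ /=.
under eq_bigr => x _ do under eq_bigr => y _ do rewrite mulr_suml.
under eq_bigr do rewrite exchange_big /=.
rewrite exchange_big; apply: eq_bigr => F _ /=.
rewrite (pair_dual_basis f) (pair_dual_basis g) -mulrA mulr_suml mulr_sumr; apply: eq_bigr => x _.
rewrite !mulr_sumr; apply: eq_bigr => y _.
move: (tcoef _ x) (tcoef _ y) (pair_dual f _) (pair_dual g _) (coprod_coef _ _ _) => a b c d e.
ring.
Qed.

(** Evaluation at [T_word I] isolates the coefficient of the class of the product of
[I] on one side; on the other side the coproduct applies, and each stable class
selects the subwords with the right product. *)
Lemma stable_structure_constants (t : W -> W -> W -> K) :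
    (forall u v, dual_mul (stable_class u) (stable_class v) = \sum_w t u v w *: stable_class w) ->
  forall u v k (I : k.-tuple 'I_n),
  t u v (wprod I) =
    \sum_(E | wprod (subword I E) == u) \sum_(F | wprod (subword I F) == v)
      stable_scale * coprod_coef I E F.
Proof.
move=> tE u v k I; apply: (mulIf stable_scale_neq0).
transitivity (pair_dual (\sum_w t u v w *: stable_class w) (T_word I)).
  rewrite T_word_elt pair_dual_sum (bigD1 (wprod I)) //= big1 => [|w /negPf ne].
    by rewrite addr0 pair_dualZ pair_stable_class eqxx.
  by rewrite pair_dualZ pair_stable_class ne mulr0.
rewrite -tE pair_dual_mul_T_word.
have pS x L : pair_dual (stable_class x) (T_word L) = stable_scale *+ (wprod L == x).
  by rewrite T_word_elt pair_stable_class eq_sym.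
rewrite [in RHS]big_mkcond mulr_suml; apply: eq_bigr => E _ /=.
transitivity (\sum_F coprod_coef I E F * (stable_scale *+ (wprod (subword I E) == u))
    * (stable_scale *+ (wprod (subword I F) == v))).
  by apply: eq_bigr => F _; congr (_ * _ * _); apply: pS.
case: eqP => _; last by rewrite mul0r big1 // => F _; rewrite mulr0n mulr0 mul0r.
rewrite [in RHS]big_mkcond mulr_suml; apply: eq_bigr => F _ /=.
case: eqP => _; last by rewrite mulr0n mulr0 mul0r.
by rewrite !mulr1n [stable_scale * _]mulrC.
Qed.

End Stable.

Definition Qa_realization r n (D : semisimple_datum r n) : realization D (Qa r) :=
  Realization (@actQ1 r n D) (@actQ_mul r n D) (@actQ_lin r n D) (@actQ_h r n D)
    (@linQB r) (@linQZ r) (@linQ_inj r) (@h_sub_linQ_neq0 r).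

Theorem theorem6p3 (r n : nat) (D : semisimple_datum r n)
    (t : weyl D -> weyl D -> weyl D -> Qa r)
    (t_def : forall u v : weyl D,
       dual_mul (stab u) (stab v) = \sum_(w : weyl D) t u v w *: stab w) :
  (forall w : weyl D,
     stab w = ((-1) ^+ wlen (w0 D) * hat_alpha_w0 D) *: T_dual w)
  /\
  (forall I : forall w : weyl D, (wlen w).-tuple 'I_n,
     (forall w : weyl D, word_prod D (I w) = w) ->
   forall u v w : weyl D,
     t u v w =
     \sum_(E : {set 'I_(wlen w)} | word_prod D (subword (I w) E) == u)
      \sum_(F : {set 'I_(wlen w)} | word_prod D (subword (I w) F) == v)
        (-1) ^+ wlen (w0 D) * hat_alpha_w0 D * t_EF D (I w) E F).
Proof.
split=> [w|I Iw u v w]; first exact: (stable_class_dual (Qa_realization D) w).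
rewrite -{1}(Iw w).
exact: (stable_structure_constants (A := Qa_realization D) t_def u v (I w)).
Qed.
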